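(* Consider the numerical method $$\begin{pmatrix}x_{n+1}\\ y_{n+1}\end{pmatrix}=A\begin{pmatrix}x_n\\ y_n\end{pmatrix}+\alpha\, b\,\Delta W_n,\qquad A=\begin{pmatrix}a_{11}&a_{12}\\ a_{21}&a_{22}\end{pmatrix},\quad b=\begin{pmatrix}b_1\\ b_2\end{pmatrix},$$ with step-size $h>0$, approximating the linear stochastic oscillator (see context), and suppose (A1) $4\det(A)-(\mathrm{tr}(A))^2>0$; (A2) $\det(A)=1$. Then: (1) The method is symplectic, i.e. $\mathrm dx_{n+1}\wedge\mathrm dy_{n+1}=\mathrm dx_n\wedge\mathrm dy_n$ for all $n\ge0$. (2) The discrete mean position $A_N=\frac1N\sum_{n=0}^{N-1}x_n$, $N\ge1$, satisfies a large deviations principle (as $N\to\infty$, with speed $N$) with the good rate function $$I^h(y)=\frac{(2+\mathrm{tr}(A))(2-\mathrm{tr}(A))^2y^2}{2\alpha^2h\left[(b_1+a_{12}b_2-a_{22}b_1)^2(4+\mathrm{tr}(A))-2b_1(a_{12}b_2-a_{22}b_1)(2-\mathrm{tr}(A))\right]}.$$ (3) Moreover, if (A1) and (A2) hold for all sufficiently small $h$ and, in addition, as $h\to0$, (B) $|a_{11}-1|+|a_{22}-1|+|a_{12}-h|+|a_{21}+h|=\mathcal O(h^2)$ and $|b_1|+|b_2-1|=\mathcal O(h)$, then the method asymptotically preserves the large deviations principle of the mean position $\{A_T\}_{T>0}$ of the exact solution, i.e. the modified rate function $I^h_{mod}(y)=I^h(y)/h$ satisfies $$\lim_{h\to0}I^h_{mod}(y)=I(y)\qquad\text{for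 all } y\in\mathbb R,$$ where $I(y)=\frac{y^2}{3\alpha^2}$ is the rate function of the large deviations principle of $\{A_T\}_{T>0}$.
   Context: Let $\alpha>0$, $x_0,y_0\in\mathbb R$ and let $W$ be a one-dimensional standard Brownian motion on a complete filtered probability space. The linear stochastic oscillator is $\mathrm dX_t=Y_t\,\mathrm dt$, $\mathrm dY_t=-X_t\,\mathrm dt+\alpha\,\mathrm dW_t$, $(X_0,Y_0)=(x_0,y_0)$, and $A_T=\frac1T\int_0^TX_t\,\mathrm dt$; $\{A_T\}_{T>0}$ satisfies a large deviations principle as $T\to\infty$ (speed $T$) with good rate function $I(y)=y^2/(3\alpha^2)$. Numerical method: for a step-size $h>0$, $t_n=nh$, $\Delta W_n=W_{t_{n+1}}-W_{t_n}$, started at $(x_0,y_0)$. The real matrix $A=A(h)$ and real vector $b=b(h)$ depend on the method and on the constant step-size $h$ (dependence suppressed in the notation), and throughout $b_1^2+b_2^2\ne0$. A family of real random variables $\{Z_N\}_{N\ge1}$ satisfies a large deviations principle with rate function $I$ (a lower semicontinuous function $\mathbb R\to[0,\infty]$; good if its level sets $\{I\le a\}$, $a\in[0,\infty)$, are compact) if $\liminf_{N\to\infty}\frac1N\log\mathbf P(Z_N\in U)\ge-\inf_UI$ for every open $U\subset\mathbb R$ and $\limsup_{N\to\infty}\frac1N\log\mathbf P(Z_N\in C)\le-\inf_CI$ for every closed $C\subset\mathbb R$. $R=\mathcal O(h^p)$ means $|R|\le Ch^p$ for all sufficiently small $h$, with $C$ independent of $h$. *)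

(* Defs.v *)
From HB Require Import structures.
From mathcomp Require Import all_boot all_order all_algebra.
From mathcomp Require Import all_classical all_reals all_analysis.

Set Implicit Arguments.
Unset Strict Implicit.
Unset Printing Implicit Defensive.

Import Order.TTheory GRing.Theory Num.Theory.
Import numFieldNormedType.Exports.
Local Open Scope classical_set_scope.
Local Open Scope ring_scope.

Section LargeDeviations.
Context (R : realType).
Local Open Scope ereal_scope.

Definition rate_function (I : R -> \bar R) : Prop :=
  (forall y, 0 <= I y) /\ lower_semicontinuous I.

Definition good_rate_function (I : R -> \bar R) : Prop :=
  rate_function I /\
  forall a : R, (0 <= a)%R -> compact [set y | I y <= a%:E].

(* The index runs along an arbitrary filter, so that the same definition covers
   sequences (filter \oo) and families indexed by a real time T -> +oo.
   lne 0 = -oo, and the infimum over the empty set is +oo. *)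
Definition satisfies_LDP d (Omega : measurableType d) (P : probability Omega R)
    (K : choiceType) (L : filteredType K) (F : set_system L)
    (speed : L -> R) (Z : L -> Omega -> R) (I : R -> \bar R) : Prop :=
  let rho (k : L) (B : set R) := ((speed k)^-1)%:E * lne (P (Z k @^-1` B)) in
  [/\ rate_function I,
      \forall k \near F, measurable_fun setT (Z k),
      forall U : set R, open U ->
        - ereal_inf (I @` U) <= limf_einf (fun k => rho k U) F &
      forall C : set R, closed C ->
        limf_esup (fun k => rho k C) F <= - ereal_inf (I @` C)].

End LargeDeviations.

(* Stochastic processes on [0, +oo[ are indexed by all of R; only the values at
   times t >= 0 are ever constrained or used. *)
Section Processes.
Context (R : realType) d (Omega : measurableType d) (P : probability Omega R).
Implicit Types (F : R -> set (set Omega)) (X Y W : R -> Omega -> R).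

Definition complete_filtration F : Prop :=
  [/\ forall t : R, 0 <= t -> sigma_algebra [set: Omega] (F t),
      forall t : R, 0 <= t -> F t `<=` measurable,
      forall s t : R, 0 <= s -> s <= t -> F s `<=` F t,
      measure_is_complete P &
      P.-negligible `<=` F 0].

Definition adapted F X : Prop :=
  forall t : R, 0 <= t -> forall B : set R, measurable B -> F t (X t @^-1` B).

(* normal_prob takes the mean and the standard deviation. *)
Definition increment W (s t : R) (w : Omega) : R := W t w - W s w.

Definition standard_brownian_motion F W : Prop :=
  [/\ adapted F W,
      {ae P, forall w, W 0 w = 0},
      {ae P, forall w, {within `[0, +oo[, continuous (fun t => W t w)}},
      forall s t : R, 0 <= s -> s < t -> forall B : set R, measurable B ->
        P (increment W s t @^-1` B) = normal_prob 0 (Num.sqrt (t - s)) B &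
      forall s t : R, 0 <= s -> s < t ->
        forall (E : set Omega) (B : set R), F s E -> measurable B ->
        P (E `&` (increment W s t @^-1` B))
          = (P E * P (increment W s t @^-1` B))%E].

(* dX = Y dt, dY = - X dt + alpha dW in integral form; the integrand of the
   Ito integral is the constant alpha, so this integral is alpha (W_t - W_0). *)
Definition stochastic_oscillator F W (alpha x0 y0 : R) X Y : Prop :=
  [/\ adapted F X, adapted F Y &
      {ae P, forall w,
        [/\ {within `[0, +oo[, continuous (fun t => X t w)},
            {within `[0, +oo[, continuous (fun t => Y t w)} &
            forall t : R, 0 <= t ->
              X t w = x0 + \int[lebesgue_measure]_(s in `[0, t]) Y s w /\
              Y t w = y0 - \int[lebesgue_measure]_(s in `[0, t]) X s w
                         + alpha * (W t w - W 0 w)]}].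

Definition time_mean X (T : R) (w : Omega) : R :=
  T^-1 * \int[lebesgue_measure]_(t in `[0, T]) X t w.

End Processes.

Section NumericalMethod.
Context (R : realType) d (Omega : measurableType d).
Implicit Types (A : 'M[R]_2) (b z : 'cV[R]_2) (alpha h : R)
  (W : R -> Omega -> R).

Definition point2 (x y : R) : 'cV[R]_2 :=
  \col_(i < 2) if i == 0 then x else y.

(* The increment is W_{t_{n+1}} - W_{t_n} with t_n = n h. *)
Fixpoint numsol A b alpha h W z (n : nat) (w : Omega) : 'cV[R]_2 :=
  if n is m.+1 then
    A *m numsol A b alpha h W z m w
      + (alpha * (W (m.+1%:R * h) w - W (m%:R * h) w)) *: b
  else z.

Definition num_x A b alpha h W z n w : R := numsol A b alpha h W z n w 0 0.
Definition num_y A b alpha h W z n w : R := numsol A b alpha h W z n w 1 0.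

Definition discrete_mean A b alpha h W z (N : nat) (w : Omega) : R :=
  N%:R^-1 * \sum_(n < N) num_x A b alpha h W z n w.

(* The 2-form df /\ dg at the point z, on the pair of tangent vectors u, v. *)
Definition wedge (f g : 'cV[R]_2 -> R) (z u v : 'cV[R]_2) : R :=
  'd f z u * 'd g z v - 'd f z v * 'd g z u.

(* dx_{n+1} /\ dy_{n+1} = dx_n /\ dy_n as 2-forms in the initial datum, for
   every realization w.  Differentiability is required because 'd is total. *)
Definition symplectic_method A b alpha h W : Prop :=
  forall (w : Omega) (n : nat),
    let x m z := num_x A b alpha h W z m w in
    let y m z := num_y A b alpha h W z m w in
    forall z : 'cV[R]_2,
      [/\ differentiable (x n) z, differentiable (y n) z &
          forall u v, wedge (x n.+1) (y n.+1) z u v = wedge (x n) (y n) z u v].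

Definition rate_h A b alpha h (y : R) : R :=
  let a12 := A 0 1 in let a22 := A 1 1 in
  let b1 := b 0 0 in let b2 := b 1 0 in
  (2 + \tr A) * (2 - \tr A) ^+ 2 * y ^+ 2
  / (2 * alpha ^+ 2 * h *
     ((b1 + a12 * b2 - a22 * b1) ^+ 2 * (4 + \tr A)
      - 2 * b1 * (a12 * b2 - a22 * b1) * (2 - \tr A))).

Definition condA1 A : Prop := 4 * \det A - (\tr A) ^+ 2 > 0.
Definition condA2 A : Prop := \det A = 1.
Definition nonzero_noise b : Prop := (b 0 0) ^+ 2 + (b 1 0) ^+ 2 != 0.

Definition condB (A : R -> 'M[R]_2) (b : R -> 'cV[R]_2) : Prop :=
  (fun h : R => `|A h 0 0 - 1| + `|A h 1 1 - 1|
                + `|A h 0 1 - h| + `|A h 1 0 + h|)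
    =O_ (0^'+) (fun h : R => h ^+ 2) /\
  (fun h : R => `|b h 0 0| + `|b h 1 0 - 1|) =O_ (0^'+) (fun h : R => h).

End NumericalMethod.

Definition rate_exact (R : realType) (alpha y : R) : R :=
  y ^+ 2 / (3 * alpha ^+ 2).

(* M h N: discrete mean position with step-size h, with rate function Ih h;
   Z T: mean position of the exact solution, with rate function I.  The modified
   rate function is Ih h / h. *)
Definition asymptotically_preserves_LDP (R : realType) d
    (Omega : measurableType d) (P : probability Omega R)
    (M : R -> nat -> Omega -> R) (Ih : R -> R -> R)
    (Z : R -> Omega -> R) (I : R -> R) : Prop :=
  [/\ \forall h \near 0^'+,
        satisfies_LDP P \oo (fun N => N%:R) (M h) (EFin \o Ih h),
      satisfies_LDP P +oo id Z (EFin \o I) &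
      forall y : R, Ih h y / h @[h --> 0^'+] --> I y].

(* Main.v *)
Require Import Defs.
From HB Require Import structures.
From mathcomp Require Import all_boot all_order all_algebra.
From mathcomp Require Import all_classical all_reals all_analysis.
From mathcomp Require Import measurable_realfun ring lra.
Import Order.TTheory GRing.Theory Num.Theory.
Import numFieldNormedType.Exports.
Local Open Scope classical_set_scope.
Local Open Scope ring_scope.

(** Both means are Gaussian.  The increments of the Brownian motion over a uniform
    grid are independent normal variables, so every weighted sum of them is normal,
    with variance proportional to the sum of the squared weights.  A family of
    Gaussian variables whose means tend to 0 and whose variances multiplied by the
    speed tend to s satisfies the large deviations principle with rate y^2 / (2 s):
    only a two-sided tail bound and a lower bound on small intervals are needed.

    For the method, [N A_N] is, up to a bounded deterministic term, [alpha] times a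
    sum of increments with weights [c_m], the first entry of
    [(1 + A + ... + A^(m-1)) b].  By Cayley-Hamilton,
    [c_m = p - q_m] with [q_(m+2) = tr(A) q_(m+1) - q_m]; since |tr A| < 2 the
    quadratic form [q_m^2 + q_(m+1)^2 - tr(A) q_m q_(m+1)] is a positive definite
    invariant, which gives the limit of the averages of [q_m] and [q_m^2].

    For the oscillator, [psi s = X_s sin (T - s) + (\int_0^s X - y0) cos (T - s)]
    has derivative [alpha W_s sin (T - s)], so [\int_0^T X] is, up to a bounded
    deterministic term, the almost sure limit of [alpha] times the grid sums with
    weights [1 - cos (T - t_(k+1))]; the Gaussian bounds survive this limit. *)

(** * Sums of independent Gaussian increments *)

Section NormalConvolution.
Context {R : realType}.
Local Notation mu := (@lebesgue_measure R).

(** Lebesgue measure is [|c|] times its image under [x |-> a + c * x], by uniqueness on the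
    intervals []x, y]]; the formula is then integration against an image measure. *)
Lemma ge0_integral_affine (a c : R) (f : R -> \bar R) : c != 0 ->
  measurable_fun [set: R] f -> (forall x, 0 <= f x)%E ->
  (\int[mu]_x f x = `|c|%:E * \int[mu]_x f (a + c * x)%R)%E.
Proof.
move=> c0 mf f0.
have mphi0 : measurable_fun [set: R] (fun x : R => a + c * x).
  by apply: measurable_funD => //; exact: measurable_funM.
have mphi : measurable_fun [set: measurableTypeR R]
    ((fun x => a + c * x) : measurableTypeR R -> measurableTypeR R) by exact: mphi0.
pose phi : measurableTypeR R -> measurableTypeR R := fun x => a + c * x.
pose nu : {measure set (measurableTypeR R) -> \bar R} :=
  mscale (NngNum (normr_ge0 c))
    (measure_function_pushforward__canonical__measure_function_Measure mu mphi).
have nuE A : measurable A -> mu A = nu A.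
  apply: lebesgue_measure_unique => _ [[x y]] _ <-.
  transitivity (`|c|%:E * mu (phi @^-1` `]x, y]%classic))%E; last by [].
  have [cp|cn] := ltP 0 c.
    have -> : phi @^-1` `]x, y]%classic = `](x - a) / c, (y - a) / c]%classic.
      apply/seteqP; split => z;
        rewrite /phi/= !in_itv/= ltr_pdivrMr// ler_pdivlMr//;
        rewrite ltrBlDl lerBrDl mulrC//.
    rewrite !lebesgue_measure_itv/= !lte_fin ltr_pM2r ?invr_gt0// ltrD2r.
    case: ifPn => xy; last by rewrite mule0.
    by rewrite -!EFinB -EFinM gtr0_norm//; congr EFin; field.
  have {}cn : c < 0 by rewrite lt_neqAle c0.
  (* For negative [c] the map reverses the order, so the preimage is closed on the left and open on
     the right. *)
  have -> : phi @^-1` `]x, y]%classic = `[(y - a) / c, (x - a) / c[%classic.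
    apply/seteqP; split => z; rewrite /phi/= !in_itv/= ltr_ndivlMr// ler_ndivrMr//;
      rewrite ltrBlDl lerBrDl mulrC andbC//.
  rewrite !lebesgue_measure_itv/= !lte_fin ltr_nM2r ?invr_lt0// ltrD2r.
  case: ifPn => xy; last by rewrite mule0.
  by rewrite -!EFinB -EFinM ltr0_norm//; congr EFin; field.
rewrite (eq_measure_integral nu)/=; last by move=> A mA _; exact: nuE.
rewrite ge0_integral_mscale//=; congr (_ * _)%E.
by rewrite ge0_integral_pushforward.
Qed.

(** The Radon-Nikodym derivative of [normal_prob] agrees almost everywhere with [normal_pdf], as
    both have the same integral over every measurable set. The bound [M] makes [f] integrable for
    the probability. *)
Lemma integral_normal_prob (m s M : R) (f : R -> \bar R) :
  measurable_fun [set: R] f -> (forall x, 0 <= f x <= M%:E)%E ->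
  (\int[normal_prob m s]_x f x = \int[mu]_x (f x * (normal_pdf m s x)%:E))%E.
Proof.
move=> mf fM.
have intf : (normal_prob m s).-integrable setT f.
  apply: (@le_integrable _ _ _ (normal_prob m s) setT _ _ (cst M%:E)) => //=.
  - move=> x _; have /andP[f0 fMx] := fM x.
    by rewrite gee0_abs// (le_trans fMx)// lee_fin ler_norm.
  - by apply: finite_measure_integrable_cst.
have dom := normal_prob_dominates m s.
rewrite -(Radon_Nikodym_change_of_variables dom)//.
apply: ae_eq_integral => //.
- by apply: emeasurable_funM => //; exact: mf.
- apply: emeasurable_funM; first exact: mf.
  apply/measurable_EFinP.
  exact: measurable_normal_pdf.
- apply: ae_eqe_mul2l; apply: integral_ae_eq => //.
  + by apply: Radon_Nikodym_integrable; exact: dom.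
  + by apply/measurable_EFinP; exact: measurable_normal_pdf.
  + by move=> E _ mE; rewrite -Radon_Nikodym_integral.
Qed.

Lemma normal_pdf_affine (x c s y : R) : c != 0 -> s != 0 ->
  `|c| * normal_pdf x (`|c| * s) (x + c * y) = normal_pdf 0 s y.
Proof.
move=> c0 s0; have cn : `|c| != 0 by rewrite normr_eq0.
rewrite !normal_pdfE ?mulf_neq0// /normal_peak /normal_fun mulrA.
congr (_ * expR _).
  have -> : (`|c| * s) ^+ 2 * pi *+ 2 = `|c| ^+ 2 * (s ^+ 2 * pi *+ 2).
    by rewrite exprMn; ring.
  rewrite sqrtrM ?sqr_ge0// sqrtr_sqr normr_id invfM mulrA mulfV// mul1r//.
rewrite exprMn -normrX ger0_norm ?sqr_ge0//.
by field; rewrite c0 s0.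
Qed.

Lemma normal_prob_affine (x c s : R) (B : set R) : c != 0 -> s != 0 ->
  measurable B ->
  normal_prob 0 s [set z | B (x + c * z)] = normal_prob x (`|c| * s) B.
Proof.
move=> c0 s0 mB; rewrite /normal_prob [LHS]integral_mkcond [RHS]integral_mkcond.
rewrite [RHS](ge0_integral_affine x c _ c0); last 2 first.
- apply/(measurable_restrictT _ mB)/measurable_funTS/measurable_EFinP.
  exact: measurable_normal_pdf.
- by move=> y; rewrite patchE; case: ifP => // _; rewrite lee_fin normal_pdf_ge0.
rewrite -ge0_integralZl//; first last.
- by move=> y _; rewrite patchE; case: ifP => // _; rewrite lee_fin normal_pdf_ge0.
- apply: (@measurableT_comp _ _ _ _ _ _ _ _ (fun z => x + c * z)).
    apply/(measurable_restrictT _ mB)/measurable_funTS/measurable_EFinP.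
    exact: measurable_normal_pdf.
  by apply: measurable_funD => //; exact: measurable_funM.
apply: eq_integral => z _; rewrite !patchE.
have -> : (z \in [set z | B (x + c * z)]) = (x + c * z \in B).
  by apply/idP/idP; rewrite !inE.
by case: ifP => _; rewrite ?mule0// -EFinM normal_pdf_affine.
Qed.

(** Completing the square in [x]: a joint density, given as the law of [x] times that of [y] knowing
    [x], becomes the marginal density of [y] times the conditional density of [x] knowing [y]. *)
Lemma normal_pdf_mul (s t x y : R) : 0 < s -> 0 < t ->
  normal_pdf x t y * normal_pdf 0 s x =
  normal_pdf 0 (Num.sqrt (s ^+ 2 + t ^+ 2)) y *
  normal_pdf (y * s ^+ 2 / (s ^+ 2 + t ^+ 2))
    (s * t / Num.sqrt (s ^+ 2 + t ^+ 2)) x.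
Proof.
move=> s0 t0; have st0 : 0 < s ^+ 2 + t ^+ 2 by rewrite addr_gt0// exprn_gt0.
set r := Num.sqrt _; have r0 : 0 < r by rewrite sqrtr_gt0.
have r2 : r ^+ 2 = s ^+ 2 + t ^+ 2 by rewrite sqr_sqrtr// ltW.
have q0 : 0 < s * t / r by rewrite divr_gt0// mulr_gt0.
rewrite !normal_pdfE ?gt_eqF// /normal_peak /normal_fun.
rewrite mulrACA [RHS]mulrACA; congr (_ * _).
  rewrite -!invfM -!sqrtrM ?mulrn_wge0 ?mulr_ge0 ?pi_ge0 ?ltW//.
  congr (Num.sqrt _)^-1; rewrite exprMn exprVn.
  by field; rewrite gt_eqF.
rewrite -!expRD; congr expR; rewrite exprMn exprVn r2.
by field; rewrite !gt_eqF.
Qed.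

Lemma normal_pdf_conv (s t y : R) : 0 < s -> 0 < t ->
  (\int[mu]_x (normal_pdf x t y * normal_pdf 0 s x)%:E =
  (normal_pdf 0 (Num.sqrt (s ^+ 2 + t ^+ 2)) y)%:E)%E.
Proof.
move=> s0 t0; under eq_integral do rewrite normal_pdf_mul// EFinM.
rewrite ge0_integralZl//; first by rewrite integral_normal_pdf mule1.
- by apply/measurable_EFinP; exact: measurable_normal_pdf.
- by move=> x _; rewrite lee_fin normal_pdf_ge0.
- by rewrite lee_fin normal_pdf_ge0.
Qed.

Lemma measurable_normal_pdf2 (t : R) : t != 0 ->
  measurable_fun [set: measurableTypeR R * measurableTypeR R]
    (fun z : measurableTypeR R * measurableTypeR R => normal_pdf z.1 t z.2).
Proof.
move=> t0; rewrite (_ : (fun z => _) =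
    (fun z : measurableTypeR R * measurableTypeR R =>
       normal_pdf 0 t (z.2 - z.1))); last first.
  by apply/funext => z; rewrite !normal_pdfE// /normal_fun subr0.
apply: (@measurableT_comp _ _ _ _ _ _ _ _
  (fun z : measurableTypeR R * measurableTypeR R => z.2 - z.1)).
  exact: measurable_normal_pdf.
exact: (measurable_funB measurable_snd measurable_fst).
Qed.

Lemma normal_probE (x t : R) (B : set R) : measurable B ->
  (normal_prob x t B = \int[mu]_y ((\1_B y)%:E * (normal_pdf x t y)%:E))%E.
Proof.
move=> mB; rewrite /normal_prob integral_mkcond; apply: eq_integral => y _.
by rewrite patchE indicE; case: ifP; rewrite ?mul1e ?mul0e.
Qed.

(** Tonelli exchanges the mixing variable [x] with the variable of [B], and [normal_pdf_conv]
    evaluates the inner integral. *)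
Lemma normal_prob_mixture (s t : R) (B : set R) : 0 < s -> 0 < t ->
  measurable B ->
  (\int[normal_prob 0 s]_x normal_prob x t B =
  normal_prob 0 (Num.sqrt (s ^+ 2 + t ^+ 2)) B)%E.
Proof.
move=> s0 t0 mB; have mpdf2 := measurable_normal_pdf2 t (lt0r_neq0 t0).
have mindic : measurable_fun [set: measurableTypeR R * measurableTypeR R]
    (fun z : measurableTypeR R * measurableTypeR R => (\1_B z.2 : R)).
  by apply: (measurableT_comp _ measurable_snd); exact: measurable_indic.
have mker : measurable_fun [set: R] (fun x : R => normal_prob x t B).
  under eq_fun do rewrite normal_probE//.
  apply: (measurable_fun_fubini_tonelli_F
    (fun z : measurableTypeR R * measurableTypeR R =>
      ((\1_B z.2)%:E * (normal_pdf z.1 t z.2)%:E)%E)).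
  - by apply: emeasurable_funM; apply/measurable_EFinP.
  - by move=> z; rewrite -EFinM lee_fin !mulr_ge0 ?normal_pdf_ge0.
rewrite (integral_normal_prob 0 s 1)//; last first.
  by move=> x; rewrite measure_ge0/= probability_le1.
transitivity (\int[mu]_x \int[mu]_y
  ((\1_B y)%:E * (normal_pdf x t y * normal_pdf 0 s x)%:E))%E.
  apply: eq_integral => x _; rewrite normal_probE//.
  rewrite -ge0_integralZr//; first last.
  - by rewrite lee_fin normal_pdf_ge0.
  - by move=> y _; rewrite -EFinM lee_fin mulr_ge0 ?normal_pdf_ge0.
  - apply: emeasurable_funM; apply/measurable_EFinP; first exact: measurable_indic.
    exact: measurable_normal_pdf.
  by apply: eq_integral => y _; rewrite EFinM muleA.
rewrite (fubini_tonelli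
  (fun z : measurableTypeR R * measurableTypeR R =>
    ((\1_B z.2)%:E * (normal_pdf z.1 t z.2 * normal_pdf 0 s z.1)%:E)%E))/=.
- rewrite normal_probE//; apply: eq_integral => y _.
  rewrite ge0_integralZl//; first by rewrite normal_pdf_conv.
  + apply/measurable_EFinP/measurable_funM; last exact: measurable_normal_pdf.
    exact: measurableT_comp mpdf2 (measurable_pair2 y).
  + by move=> x _; rewrite lee_fin mulr_ge0 ?normal_pdf_ge0.
- apply: emeasurable_funM; apply/measurable_EFinP => //.
  apply: measurable_funM => //.
  by apply: (measurableT_comp (measurable_normal_pdf 0 s)) measurable_fst.
- by move=> z; rewrite -EFinM lee_fin !mulr_ge0 ?normal_pdf_ge0.
Qed.

(** Independence makes the law of the pair a product measure, so [X] can be frozen at [x]. Then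
    [x + c * Z] is normal with mean [x] and standard deviation [|c| * t], and mixing over [x] adds
    the variances. *)
Lemma normal_law_addZ d (Omega : measurableType d) (P : probability Omega R)
    (X Z : Omega -> R) (s t c : R) : 0 < s -> 0 < t -> c != 0 ->
  measurable_fun setT X -> measurable_fun setT Z ->
  (forall B, measurable B -> P (X @^-1` B) = normal_prob 0 s B) ->
  (forall B, measurable B -> P (Z @^-1` B) = normal_prob 0 t B) ->
  (forall A B, measurable A -> measurable B ->
    P (X @^-1` A `&` Z @^-1` B) = P (X @^-1` A) * P (Z @^-1` B))%E ->
  forall B, measurable B ->
    P ((fun w => X w + c * Z w) @^-1` B) =
    normal_prob 0 (Num.sqrt (s ^+ 2 + c ^+ 2 * t ^+ 2)) B.
Proof.
move=> s0 t0 c0 mX mZ PX PZ ind B mB.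
have mXZ : measurable_fun [set: Omega]
    (fun w => (X w, Z w) : measurableTypeR R * measurableTypeR R).
  by apply/measurable_fun_pair; [exact: mX | exact: mZ].
pose E := [set p : measurableTypeR R * measurableTypeR R | B (p.1 + c * p.2)].
have mE : measurable E.
  rewrite -[E]setTI.
  have mf : measurable_fun [set: measurableTypeR R * measurableTypeR R]
      (fun p => p.1 + c * p.2 : R).
    apply: (measurable_funD measurable_fst).
    by apply: (measurable_funM _ measurable_snd).
  exact: mf.
have := @product_measure_unique _ _ _ _ _ (normal_prob 0 s) (normal_prob 0 t)
  (measure_function_pushforward__canonical__measure_function_Measure P mXZ).
(* Both measures agree on rectangles by independence. *)
move=> /(_ _ E mE) PE; transitivity ((normal_prob 0 s \x normal_prob 0 t) E)%E.
  by rewrite PE// => A C mA mC; have := ind A C mA mC; rewrite (PX _ mA) (PZ _ mC).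
rewrite /product_measure1.
transitivity (\int[normal_prob 0 s]_x normal_prob x (`|c| * t) B)%E.
  apply: eq_integral => x _ /=; rewrite -normal_prob_affine//;
    last exact: lt0r_neq0.
  by congr (normal_prob _ _ _); apply/seteqP; split => z; rewrite /xsection/= inE.
have ct0 : 0 < `|c| * t by rewrite mulr_gt0 ?normr_gt0.
rewrite (normal_prob_mixture _ _ _ s0 ct0 mB).
by rewrite exprMn real_normK ?num_real.
Qed.

End NormalConvolution.

(** * Functions measurable for a sub-sigma-algebra *)

Section AdaptedFunctions.
Context {R : realType}.

(** Turns membership of preimages in [G] into measurability on the type carrying [G], so that the
    closure properties of measurable functions apply to adapted processes. *)
Lemma measurable_fun_sub_sigma_algebra (T : pointedType)
    (G : set (set T)) (f : T -> R) :
  sigma_algebra setT G ->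
  measurable_fun setT (f : g_sigma_algebraType G -> R) <->
  (forall B, measurable B -> G (f @^-1` B)).
Proof.
move=> sG; have eG : <<s G >> = G by apply: sigma_algebra_id.
split => [mf B mB|h _ B mB].
  by have := mf measurableT B mB; rewrite setTI /measurable/= eG.
by rewrite setTI /measurable/= eG; exact: h.
Qed.

Lemma adapted_addZ d (Omega : measurableType d) (G : set (set Omega))
    (X Z : Omega -> R) (c : R) :
  sigma_algebra setT G ->
  (forall B, measurable B -> G (X @^-1` B)) ->
  (forall B, measurable B -> G (Z @^-1` B)) ->
  (forall B, measurable B -> G ((fun w => X w + c * Z w) @^-1` B)).
Proof.
move=> sG /(measurable_fun_sub_sigma_algebra _ _ _ sG) mX.
move=> /(measurable_fun_sub_sigma_algebra _ _ _ sG) mZ.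
apply/(measurable_fun_sub_sigma_algebra _ _ _ sG).
by apply: measurable_funD => //; exact: measurable_funM.
Qed.

End AdaptedFunctions.

(** * Weighted sums of Brownian increments over a uniform grid *)

Section GridSums.
Context {R : realType}.

(** The Wiener integral of the step function equal to [c k] on the [k]-th cell of mesh [dl]. *)
Definition grid_sum d (Omega : measurableType d) (W : R -> Omega -> R) (dl : R)
    (c : nat -> R) (n : nat) (w : Omega) : R :=
  \sum_(k < n) c k * increment W (k%:R * dl) (k.+1%:R * dl) w.

Arguments grid_sum {d Omega}.

Section BrownianSums.
Context d (Omega : measurableType d) (P : probability Omega R).
Context (F : R -> set (set Omega)) (W : R -> Omega -> R) (dl : R).
Hypothesis hF : complete_filtration P F.
Hypothesis hW : standard_brownian_motion P F W.
Hypothesis dl0 : 0 < dl.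
Variable c : nat -> R.

Local Notation tm n := (n%:R * dl).

Let tm_ge0 n : 0 <= tm n. Proof. by rewrite mulr_ge0// ltW. Qed.

Let tm_ltS n : tm n < tm n.+1. Proof. by rewrite ltr_pM2r// ltr_nat. Qed.

Let sF (t : R) : 0 <= t -> sigma_algebra [set: Omega] (F t).
Proof. by move=> t0; case: hF => + _ _ _ _; exact. Qed.

Let F_le (s t : R) : 0 <= s -> s <= t -> F s `<=` F t.
Proof. by move=> s0 st; case: hF => _ _ + _ _; exact. Qed.

Let F_meas (t : R) (B : set Omega) : 0 <= t -> F t B -> measurable B.
Proof. by move=> t0; case: hF => _ + _ _ _; apply. Qed.

Lemma grid_sumS n : grid_sum W dl c n.+1 =
  (fun w => grid_sum W dl c n w + c n * increment W (tm n) (tm n.+1) w).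
Proof. by apply/funext => w; rewrite /grid_sum big_ord_recr. Qed.

Lemma increment_adapted (s t : R) : 0 <= s -> s <= t ->
  forall B, measurable B -> F t (increment W s t @^-1` B).
Proof.
move=> s0 st; have t0 := le_trans s0 st; case: hW => aW _ _ _ _.
have -> : increment W s t = (fun w => W t w + (-1) * W s w).
  by apply/funext => w; rewrite mulN1r.
apply: adapted_addZ; first exact: sF.
- by move=> B mB; exact: aW.
- by move=> B mB; apply: (F_le s t) => //; exact: aW.
Qed.

(** Adaptedness at time [n%:R * dl] is what makes the first [n] terms independent of the next
    increment. *)
Lemma grid_sum_adapted n B : measurable B -> F (tm n) (grid_sum W dl c n @^-1` B).
Proof.
elim: n B => [|n IH] B mB.
  move: B mB; apply/(measurable_fun_sub_sigma_algebra _ _ _ (sF _ (tm_ge0 0))).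
  rewrite (_ : grid_sum _ _ _ _ = cst 0)//.
  by apply/funext => w; rewrite /grid_sum big_ord0.
rewrite grid_sumS; move: B mB; apply: adapted_addZ; first exact: sF.
- by move=> B mB; apply: (F_le (tm n)); [|exact/ltW/tm_ltS|exact: IH].
- by apply: increment_adapted => //; exact/ltW/tm_ltS.
Qed.

Lemma measurable_grid_sum n : measurable_fun setT (grid_sum W dl c n).
Proof.
move=> _ B mB; rewrite setTI.
by apply: (F_meas _ _ (tm_ge0 n)); exact: grid_sum_adapted.
Qed.

Lemma grid_sum_eq0 n : \sum_(k < n) c k ^+ 2 = 0 -> grid_sum W dl c n = cst 0.
Proof.
move=> /eqP; rewrite psumr_eq0; last by move=> i _; exact: sqr_ge0.
move=> /allP c0; apply/funext => w; rewrite /grid_sum big1//= => i _.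
have := c0 i (mem_index_enum i); rewrite /= sqrf_eq0 => /eqP ->.
by rewrite mul0r.
Qed.

(** Induction on [n], adding one independent increment at a time. Positivity of the sum of squares
    keeps the standard deviation nonzero; the cases where the new weight or all earlier weights
    vanish are therefore treated apart. *)
Lemma grid_sum_law n B : 0 < \sum_(k < n) c k ^+ 2 -> measurable B ->
  P (grid_sum W dl c n @^-1` B) =
  normal_prob 0 (Num.sqrt (dl * \sum_(k < n) c k ^+ 2)) B.
Proof.
case: (hW) => _ _ _ lawW indW.
elim: n B => [|n IH] B; first by rewrite big_ord0 ltxx.
rewrite big_ord_recr/= => spos mB.
set Z := increment W (tm n) (tm n.+1).
have lawZ A : measurable A -> P (Z @^-1` A) = normal_prob 0 (Num.sqrt dl) A.
  move=> mA; rewrite (lawW _ _ (tm_ge0 n) (tm_ltS n) _ mA).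
  congr (normal_prob 0 (Num.sqrt _) A).
  by rewrite -natr1 mulrDl mul1r addrAC subrr add0r.
have sdl0 : 0 < Num.sqrt dl by rewrite sqrtr_gt0.
have [cn0|cn0] := eqVneq (c n) 0.
  move: spos; rewrite cn0 expr0n/= addr0 => spos.
  rewrite (_ : grid_sum _ _ _ _ = grid_sum W dl c n); first exact: IH.
  by apply/funext => w; rewrite grid_sumS cn0 mul0r addr0.
have [s0|s0] := eqVneq (\sum_(k < n) c k ^+ 2) 0.
  rewrite grid_sumS (grid_sum_eq0 _ s0) s0 add0r (mulrC dl).
  rewrite sqrtrM ?sqr_ge0// sqrtr_sqr.
  rewrite -normal_prob_affine//; last exact: lt0r_neq0.
  rewrite -lawZ//.
  rewrite -[X in measurable X]setTI.
  have mf : measurable_fun [set: R] (fun z : R => 0 + c n * z).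
    by apply: measurable_funD => //; exact: measurable_funM.
  exact: mf.
have {}s0 : 0 < \sum_(k < n) c k ^+ 2.
  by rewrite lt0r s0/= sumr_ge0// => i _; exact: sqr_ge0.
have sn0 : 0 < Num.sqrt (dl * \sum_(k < n) c k ^+ 2).
  by rewrite sqrtr_gt0 mulr_gt0.
have mZ : measurable_fun setT Z.
  move=> _ A mA; rewrite setTI; apply: (F_meas _ _ (tm_ge0 n.+1)).
  by apply: increment_adapted => //; exact/ltW/tm_ltS.
have lawS A : measurable A -> P (grid_sum W dl c n @^-1` A) =
    normal_prob 0 (Num.sqrt (dl * \sum_(k < n) c k ^+ 2)) A by exact: IH.
have indS A C : measurable A -> measurable C ->
    (P (grid_sum W dl c n @^-1` A `&` Z @^-1` C) =
    P (grid_sum W dl c n @^-1` A) * P (Z @^-1` C))%E.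
  move=> mA mC; apply: (indW _ _ (tm_ge0 n) (tm_ltS n)) => //.
  exact: grid_sum_adapted.
rewrite grid_sumS (normal_law_addZ _ _ _ _ _ _ _ _ sn0 sdl0 cn0
  (measurable_grid_sum n) mZ lawS lawZ indS B mB).
congr (normal_prob 0 (Num.sqrt _) B).
rewrite !sqr_sqrtr ?(ltW dl0)// ?mulr_ge0 ?(ltW dl0) ?(ltW s0)//.
by rewrite mulrDr (mulrC (c n ^+ 2)).
Qed.

End BrownianSums.

End GridSums.
Arguments grid_sum {R d Omega}.
Arguments measurable_grid_sum {R d Omega P F W dl}.
Arguments grid_sum_law {R d Omega P F W dl}.

(** * Large deviations from Gaussian bounds *)

Section GaussianBounds.
Context {R : realType}.
Local Notation mu := (@lebesgue_measure R).

Lemma normal_pdf_sqrtE (m v x : R) : 0 < v ->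
  normal_pdf m (Num.sqrt v) x =
  (Num.sqrt (2 * pi * v))^-1 * expR (- (x - m) ^+ 2 / (2 * v)).
Proof.
move=> v0; rewrite normal_pdfE ?sqrtr_eq0 -?ltNge//.
rewrite /normal_peak /normal_fun sqr_sqrtr ?ltW//.
by congr ((Num.sqrt _)^-1 * expR (_ / _)); ring.
Qed.

(* For `|x| >= r the density at x is at most expR (- r^2 / 2v) times the sum of
   the densities of the same variance centred at r and at - r. *)
Lemma normal_prob_tail (v r : R) : 0 < v -> 0 <= r ->
  (normal_prob 0 (Num.sqrt v) [set x | (r <= `|x|)%R] <=
  (2 * expR (- r ^+ 2 / (2 * v)))%:E)%E.
Proof.
move=> v0 r0; set s := Num.sqrt v; set e := expR _; rewrite /normal_prob.
have mpdf m : measurable_fun [set: R] (fun x => (normal_pdf m s x)%:E).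
  by apply/measurable_EFinP; exact: measurable_normal_pdf.
have mA : measurable [set x : R | r <= `|x|].
  rewrite -[X in measurable X]setTI.
  by apply: measurable_fun_le => //; exact: measurableT_comp.
rewrite integral_mkcond.
apply: (@le_trans _ _ (\int[mu]_x (e%:E * (normal_pdf r s x)%:E +
    e%:E * (normal_pdf (- r) s x)%:E))%E); last first.
  rewrite ge0_integralD//; first last.
  - by apply: emeasurable_funM => //; exact: mpdf.
  - by move=> x _; rewrite -EFinM lee_fin mulr_ge0 ?normal_pdf_ge0 ?expR_ge0.
  - by apply: emeasurable_funM => //; exact: mpdf.
  - by move=> x _; rewrite -EFinM lee_fin mulr_ge0 ?normal_pdf_ge0 ?expR_ge0.
  rewrite !ge0_integralZl ?lee_fin ?expR_ge0//.
  - rewrite !integral_normal_pdf !mule1 -EFinD lee_fin.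
    by rewrite mulrDl mul1r lexx.
  - exact: mpdf.
  - by move=> x _; rewrite lee_fin normal_pdf_ge0.
  - exact: mpdf.
  - by move=> x _; rewrite lee_fin normal_pdf_ge0.
apply: ge0_le_integral => //.
- by move=> x _; rewrite patchE; case: ifP => // _; rewrite lee_fin normal_pdf_ge0.
- by apply/(measurable_restrictT _ mA)/measurable_funTS; exact: mpdf.
- by apply: emeasurable_funD; apply: emeasurable_funM => //; exact: mpdf.
move=> x _; rewrite patchE; case: ifP => [|_]; last first.
  by rewrite -!EFinM -EFinD lee_fin addr_ge0// mulr_ge0 ?normal_pdf_ge0 ?expR_ge0.
rewrite inE/= => rx; rewrite -!EFinM -EFinD lee_fin !normal_pdf_sqrtE//.
set p := (Num.sqrt _)^-1; have p0 : 0 <= p by rewrite invr_ge0.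
rewrite !(mulrCA e) -mulrDr ler_wpM2l// -!expRD.
have key z : 0 <= z * r -> r ^+ 2 <= z * r ->
    expR (- z ^+ 2 / (2 * v)) <=
    expR (- r ^+ 2 / (2 * v) + - (z - r) ^+ 2 / (2 * v)).
  move=> zr0 rz; rewrite ler_expR -mulrDl ler_pM2r ?invr_gt0 ?mulr_gt0//.
  have -> : - r ^+ 2 + - (z - r) ^+ 2 = - z ^+ 2 + 2 * (z * r - r ^+ 2) by ring.
  by rewrite lerDl mulr_ge0// subr_ge0.
(* The density centred on the side of [x] suffices; the other one is dropped as nonnegative. *)
have [x0|x0] := leP 0 x.
  rewrite ger0_norm// in rx; rewrite ler_wpDr ?expR_ge0// subr0.
  by apply: key; rewrite ?mulr_ge0// expr2 ler_wpM2r.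
rewrite ltr0_norm// in rx; rewrite ler_wpDl ?expR_ge0// subr0.
have -> : - x ^+ 2 = - (- x) ^+ 2 by ring.
have -> : - (x - - r) ^+ 2 = - (- x - r) ^+ 2 by ring.
have x0' : 0 <= - x by rewrite oppr_ge0 ltW.
by apply: key; rewrite ?mulr_ge0// expr2 ler_wpM2r.
Qed.

(** On the ball [|x|] stays below [|y| + e], so the density is at least its value at that distance;
    the ball has length [2 * e]. *)
Lemma normal_prob_ball (v y e : R) : 0 < v -> 0 < e ->
  ((2 * e / Num.sqrt (2 * pi * v) * expR (- (`|y| + e) ^+ 2 / (2 * v)))%:E <=
  normal_prob 0 (Num.sqrt v) [set x | (`|x - y| < e)%R])%E.
Proof.
move=> v0 e0; set s := Num.sqrt v; rewrite /normal_prob.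
have -> : [set x | `|x - y| < e] = `](y - e), (y + e)[%classic.
  by apply/seteqP; split => x; rewrite /= in_itv/= ltr_distl.
pose c := (Num.sqrt (2 * pi * v))^-1 * expR (- (`|y| + e) ^+ 2 / (2 * v)).
apply: (@le_trans _ _ (\int[mu]_(x in `](y - e)%R, (y + e)%R[) c%:E)%E).
  rewrite integral_cst//= lebesgue_measure_itv/= lte_fin.
  rewrite (_ : y - e < y + e); last by rewrite ltrD2l gtrN.
  by rewrite -EFinB -EFinM lee_fin /c le_eqVlt; apply/orP; left; apply/eqP; ring.
apply: ge0_le_integral => //.
- by move=> x _; rewrite lee_fin mulr_ge0 ?invr_ge0 ?expR_ge0.
- by apply/measurable_funTS/measurable_EFinP; exact: measurable_normal_pdf.
move=> x /=; rewrite in_itv/= -ltr_distl => xy.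
rewrite lee_fin normal_pdf_sqrtE// ler_wpM2l ?invr_ge0// ler_expR subr0.
rewrite ler_pM2r ?invr_gt0 ?mulr_gt0// lerN2 -[x ^+ 2]real_normK ?num_real//.
rewrite lerXn2r ?nnegrE ?addr_ge0 ?(ltW e0)//.
have -> : x = y + (x - y) by ring.
by rewrite (le_trans (ler_normD _ _))// lerD2l ltW.
Qed.

(** Only these two inequalities of the centred normal law of variance [v] are retained: they suffice
    for the large deviations principle and survive almost sure limits. *)
Definition gaussian_bounds d (Omega : measurableType d) (P : probability Omega R)
    (Z : Omega -> R) (v : R) : Prop :=
  [/\ measurable_fun setT Z,
      forall r : R, 0 <= r ->
        (P [set w | (r <= `|Z w|)%R] <= (2 * expR (- r ^+ 2 / (2 * v)))%:E)%E &
      forall y e : R, 0 < e ->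
        ((2 * e / Num.sqrt (2 * pi * v) * expR (- (`|y| + e) ^+ 2 / (2 * v)))%:E
        <= P [set w | (`|Z w - y| < e)%R])%E].

Arguments gaussian_bounds {d Omega}.

Lemma normal_law_bounds d (Omega : measurableType d) (P : probability Omega R)
    (Z : Omega -> R) (v : R) : 0 < v -> measurable_fun setT Z ->
  (forall B, measurable B -> P (Z @^-1` B) = normal_prob 0 (Num.sqrt v) B) ->
  gaussian_bounds P Z v.
Proof.
move=> v0 mZ lawZ; split => // [r r0|y e e0].
  have mA : measurable [set x : R | r <= `|x|].
    rewrite -[X in measurable X]setTI.
    by apply: measurable_fun_le => //; exact: measurableT_comp.
  have := normal_prob_tail _ _ v0 r0; rewrite -(lawZ _ mA); exact.
have mA : measurable [set x : R | `|x - y| < e].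
  rewrite (_ : [set _ | _] = `](y - e), (y + e)[%classic)//.
  by apply/seteqP; split => x; rewrite /= in_itv/= ltr_distl.
have := normal_prob_ball _ y _ v0 e0; rewrite -(lawZ _ mA); exact.
Qed.

Lemma gaussian_boundsZ d (Omega : measurableType d) (P : probability Omega R)
    (Z : Omega -> R) (v a : R) : 0 < v -> a != 0 -> gaussian_bounds P Z v ->
  gaussian_bounds P (fun w => a * Z w) (a ^+ 2 * v).
Proof.
move=> v0 a0 [mZ Zu Zl]; have an0 : 0 < `|a| by rewrite normr_gt0.
split => [|r r0|y e e0]; first exact: measurable_funM.
  have := Zu (r / `|a|); rewrite divr_ge0// => /(_ erefl).
  have -> : [set w | r / `|a| <= `|Z w|] = [set w | r <= `|a * Z w|].
    by apply/seteqP; split => w /=; rewrite ler_pdivrMr// normrM mulrC.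
  move/le_trans; apply; rewrite lee_fin ler_wpM2l// ler_expR.
  rewrite le_eqVlt; apply/orP; left.
  rewrite exprMn exprVn real_normK ?num_real//; apply/eqP; field.
  by rewrite a0 gt_eqF.
have := Zl (y / a) (e / `|a|); rewrite divr_gt0// => /(_ erefl).
have -> : [set w | `|Z w - y / a| < e / `|a| ] = [set w | `|a * Z w - y| < e].
  by apply/seteqP; split => w /=;
    rewrite ltr_pdivlMr// -normrM mulrBl divfK// [a * _]mulrC.
apply: le_trans; rewrite lee_fin le_eqVlt; apply/orP; left; apply/eqP.
have -> : 2 * pi * (a ^+ 2 * v) = a ^+ 2 * (2 * pi * v) by ring.
rewrite sqrtrM ?sqr_ge0// sqrtr_sqr invfM !mulrA; congr (_ * expR _).
rewrite normrM normfV -mulrDl exprMn exprVn real_normK ?num_real//; field.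
by rewrite a0 gt_eqF.
Qed.

End GaussianBounds.
Arguments gaussian_bounds {R d Omega}.

(** * Lower and upper limits along a filter, quadratic rate functions *)

Section LargeDeviationBounds.
Context {R : realType}.

Lemma cvg_invn : (n%:R^-1 : R) @[n --> \oo] --> (0 : R).
Proof.
apply/gtr0_cvgV0; last exact: cvgr_idn.
by near=> n; rewrite ltr0n; near: n; exact: nbhs_infty_gt.
Unshelve. all: by end_near. Qed.

Section LimsupBounds.
Context {K : choiceType} {L : filteredType K}.
Variables (F : set_system L) (f : L -> \bar R).
Local Open Scope ereal_scope.

Lemma limf_esup_le (a : \bar R) :
  (\forall k \near F, f k <= a) -> limf_esup f F <= a.
Proof.
move=> Fa; rewrite limf_esupE; apply: ge_ereal_inf.
exists (ereal_sup (f @` [set k | f k <= a])); first by exists [set k | f k <= a].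
by apply: ge_ereal_sup => _ [k ka <-].
Qed.

Lemma limf_einf_ge (a : \bar R) :
  (\forall k \near F, a <= f k) -> a <= limf_einf f F.
Proof.
move=> Fa; rewrite limf_einfE; apply: le_ereal_sup_tmp.
exists (ereal_inf (f @` [set k | a <= f k])); first by exists [set k | a <= f k].
by apply: le_ereal_inf_tmp => _ [k ka <-].
Qed.

End LimsupBounds.

Lemma lee_dense (x y : \bar R) :
  (forall a : R, (a%:E < x)%E -> (a%:E <= y)%E) -> (x <= y)%E.
Proof.
move=> xy; rewrite leNgt; apply/negP => yx.
have [a ya ax] : exists2 a : R, (y < a%:E)%E & (a%:E < x)%E.
  move: x y yx {xy} => [x| |] [y| |]//=; rewrite ?lte_fin => yx.
  - by exists ((x + y) / 2); rewrite lte_fin; lra.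
  - by exists (x - 1); rewrite ?ltNyr// lte_fin; lra.
  - by exists (y + 1); rewrite ?ltry// lte_fin; lra.
  - by exists 0; rewrite ?ltNyr ?ltry.
by have := xy a ax; rewrite leNgt ya.
Qed.

(** The level sets are the segments between [- sqrt (a / c)] and [sqrt (a / c)]; lower
    semicontinuity comes from continuity. *)
Lemma good_rate_quadratic (c : R) : 0 < c ->
  good_rate_function (EFin \o (fun y : R => c * y ^+ 2)).
Proof.
move=> c0; split; first split.
- by move=> y; rewrite lee_fin mulr_ge0 ?sqr_ge0// ltW.
- move=> x a; rewrite /= lte_fin => ax.
  have cf : {for x, continuous (fun y : R => c * y ^+ 2)}.
    by apply: cvgM; [exact: cvg_cst | exact: exprn_continuous].
  exists [set y | a < c * y ^+ 2]; last by move=> y /=; rewrite lte_fin.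
  by have := cf; move/cvgr_gt/(_ _ ax).
- move=> a a0.
  rewrite (_ : [set y | _] = `[- Num.sqrt (a / c), Num.sqrt (a / c)]%classic).
    exact: segment_compact.
  apply/seteqP; split => y; rewrite /= lee_fin in_itv/= -ler_norml => h.
    by rewrite -sqrtr_sqr ler_wsqrtr// ler_pdivlMr// mulrC.
  rewrite -real_normK ?num_real// mulrC -ler_pdivlMr//.
  by rewrite -[leRHS]sqr_sqrtr ?divr_ge0 ?(ltW c0)// lerXn2r// ?nnegrE.
Qed.

End LargeDeviationBounds.

(** * Large deviations of asymptotically centred Gaussian families *)

Section GaussianLargeDeviations.
Context {R : realType}.

Lemma cvg_sqr (T : Type) (F : set_system T) {FF : Filter F} (f : T -> R) (a : R) :
  f x @[x --> F] --> a -> f x ^+ 2 @[x --> F] --> a ^+ 2.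
Proof. by move=> fa; rewrite expr2; under eq_fun do rewrite expr2; exact: cvgM. Qed.

Section GaussianLDP.
Context d (Omega : measurableType d) (P : probability Omega R).
Context (K : choiceType) (L : filteredType K) (F : set_system L) {FF : Filter F}.
Variables (speed m v : L -> R) (Z : L -> Omega -> R) (sg2 : R).
Hypothesis sg20 : 0 < sg2.
Hypothesis speed_cvg : speed k @[k --> F] --> +oo.
Hypothesis m_cvg : m k @[k --> F] --> 0.
Hypothesis v_cvg : speed k * v k @[k --> F] --> sg2.
Hypothesis bounds :
  \forall k \near F, 0 < v k /\ gaussian_bounds P (fun w => Z k w - m k) (v k).

Let I (y : R) : R := (2 * sg2)^-1 * y ^+ 2.

Let rho (k : L) (B : set R) := (((speed k)^-1)%:E * lne (P (Z k @^-1` B)))%E.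

Let speed_gt0 : \forall k \near F, 0 < speed k.
Proof. by move/cvgryPgt : speed_cvg; exact. Qed.

Let inv_speed : (speed k)^-1 @[k --> F] --> 0.
Proof. by apply/gtr0_cvgV0. Qed.

Let measZ : \forall k \near F, measurable_fun setT (Z k).
Proof.
near=> k; have : 0 < v k /\ gaussian_bounds P (fun w => Z k w - m k) (v k).
  by near: k; exact: bounds.
move=> [_ [mZ _ _]]; rewrite (_ : Z k = (fun w => (Z k w - m k) + m k)).
  exact: measurable_funD.
by apply/funext => w; rewrite subrK.
Unshelve. all: by end_near. Qed.

Let log_bound_le (k : L) (B : set R) (a : R) : 0 < speed k ->
  (P (Z k @^-1` B) <= (expR (speed k * a))%:E)%E -> (rho k B <= a%:E)%E.
Proof.
(* A null event is handled apart: its logarithm is -oo, which satisfies every upper bound. *)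
move=> s0 PB; rewrite /rho; case: (ltP 0%E (P (Z k @^-1` B))) => [P0|P0].
  have le : (lne (P (Z k @^-1` B)) <= (speed k * a)%:E)%E.
    rewrite -[speed k * a]expRK -lne_EFin ?expR_gt0//.
    by rewrite lee_lne ?in_itv/= ?leey ?andbT ?(ltW P0) ?lee_fin ?expR_ge0.
  rewrite (@le_trans _ _ (((speed k)^-1)%:E * (speed k * a)%:E)%E)//.
    by rewrite lee_wpmul2l// lee_fin invr_ge0 ltW.
  by rewrite -EFinM mulKf// gt_eqF.
by rewrite le0_lneNy// gt0_muleNy ?leNye// lte_fin invr_gt0.
Qed.

Let log_bound_ge (k : L) (B : set R) (a : R) : 0 < speed k ->
  ((expR (speed k * a))%:E <= P (Z k @^-1` B))%E -> (a%:E <= rho k B)%E.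
Proof.
move=> s0 PB; rewrite /rho.
have le : ((speed k * a)%:E <= lne (P (Z k @^-1` B)))%E.
  rewrite -[speed k * a]expRK -lne_EFin ?expR_gt0//.
  by rewrite lee_lne ?in_itv/= ?leey ?andbT ?measure_ge0 ?lee_fin ?expR_ge0.
rewrite (@le_trans _ _ (((speed k)^-1)%:E * (speed k * a)%:E)%E)//.
  by rewrite -EFinM mulKf// gt_eqF.
by rewrite lee_wpmul2l// lee_fin invr_ge0 ltW.
Qed.

Let v_cvg0 : v k @[k --> F] --> 0.
Proof.
have : (speed k)^-1 * (speed k * v k) @[k --> F] --> 0 * sg2 by exact: cvgM.
rewrite mul0r; apply: cvg_trans; apply: near_eq_cvg; near=> k.
rewrite mulKf// gt_eqF//; near: k; exact: speed_gt0.
Unshelve. all: by end_near. Qed.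

Let nm_cvg : `|m k| @[k --> F] --> 0.
Proof. by rewrite -(@normr0 _ R); exact: cvg_norm. Qed.

(** If [I] is at least [j] on [C], then [C] lies outside the open ball of radius
    [sqrt (2 * sg2 * j)], and the tail bound applies at that radius less [|m k|]. The factor 2
    contributes [ln 2] divided by the speed, which vanishes. *)
Let LDP_upper (C : set R) : closed C ->
  (limf_esup (fun k => rho k C) F <= - ereal_inf ((EFin \o I) @` C))%E.
Proof.
move=> cC; rewrite leeNr; apply: lee_dense => i iC.
rewrite leeNr; apply: limf_esup_le.
(* For negative [i] it is enough that probabilities are at most 1. *)
have [i0|i0] := ltP i 0.
  near=> k; rewrite -EFinN; apply: log_bound_le.
    by near: k; exact: speed_gt0.
  rewrite (le_trans (probability_le1 P _))//.
    rewrite -[X in measurable X]setTI.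
    have /(_ _ C) : measurable_fun setT (Z k) by near: k; exact: measZ.
    by apply => //; exact: closed_measurable.
  rewrite lee_fin -[leLHS]expR0 ler_expR mulr_ge0 ?oppr_ge0 ?(ltW i0)//.
  by apply: ltW; near: k; exact: speed_gt0.
(* The gap between [i] and [j] absorbs the vanishing corrections; if the infimum is +oo, any [j]
   above [i] will do. *)
have [j ij jC] : exists2 j : R, i < j & (j%:E <= ereal_inf ((EFin \o I) @` C))%E.
  move: (ereal_inf _) iC => [x| |]; rewrite ?lte_fin// => ix.
    by exists ((i + x) / 2); rewrite ?lee_fin; lra.
  by exists (i + 1); rewrite ?leey; lra.
pose r := Num.sqrt (2 * sg2 * j).
have j0 : 0 < j by rewrite (le_lt_trans i0).
have r2 : r ^+ 2 = 2 * sg2 * j by rewrite sqr_sqrtr// !mulr_ge0// ltW.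
have r0 : 0 < r by rewrite sqrtr_gt0 !mulr_gt0.
have Cr y : C y -> r <= `|y|.
  move=> Cy; have : (j%:E <= (I y)%:E)%E.
    by apply: (le_trans jC); apply: ereal_inf_lbound; exists y.
  rewrite lee_fin /I mulrC ler_pdivlMr ?mulr_gt0// mulrC -r2 => ry.
  by rewrite -(ger0_norm (ltW r0)) -!sqrtr_sqr ler_wsqrtr.
have lim : (speed k)^-1 * ln 2 - (r - `|m k|) ^+ 2 / (2 * (speed k * v k))
    @[k --> F] --> - j.
  have -> : - j = 0 * ln 2 - (r - 0) ^+ 2 / (2 * sg2).
    by rewrite subr0 r2; field; rewrite gt_eqF.
  apply: cvgB; first by apply: cvgM => //; exact: cvg_cst.
  apply: cvgM; first by apply: cvg_sqr; apply: cvgB => //; exact: cvg_cst.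
  apply: cvgV; first by rewrite mulf_neq0// gt_eqF.
  by apply: cvgM => //; exact: cvg_cst.
have mr : \forall k \near F, `|m k| <= r by exact: (cvgr_le _ nm_cvg).
near=> k; rewrite -EFinN; have s0 : 0 < speed k by near: k; exact: speed_gt0.
apply: log_bound_le => //.
have [v0 [mZ Zu _]] : 0 < v k /\ gaussian_bounds P (fun w => Z k w - m k) (v k).
  by near: k; exact: bounds.
have mrk : `|m k| <= r by near: k.
apply: (@le_trans _ _ (P [set w | r - `|m k| <= `|Z k w - m k|])).
  apply: le_measure; rewrite ?inE.
  - rewrite -[X in measurable X]setTI.
    have /(_ _ C) : measurable_fun setT (Z k) by near: k; exact: measZ.
    by apply => //; exact: closed_measurable.
  - rewrite -[X in measurable X]setTI.
    by apply: measurable_fun_le => //; exact: measurableT_comp.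
  - move=> w /= /Cr rz; rewrite lerBlDr (le_trans rz)//.
    by rewrite -{1}(subrK (m k) (Z k w)) ler_normD.
rewrite (le_trans (Zu _ _)) ?subr_ge0// lee_fin.
rewrite -{1}(@lnK _ 2) ?posrE// -expRD ler_expR.
rewrite mulrN -lerNr -ler_pdivlMl//.
have -> : (speed k)^-1 * - (ln 2 + - (r - `|m k|) ^+ 2 / (2 * v k)) =
  - ((speed k)^-1 * ln 2 - (r - `|m k|) ^+ 2 / (2 * (speed k * v k))).
  by field; rewrite !gt_eqF.
rewrite lerNr ltW//; near: k.
by apply: (cvgr_lt _ lim); rewrite ltrN2.
Unshelve. all: by end_near. Qed.

(** It suffices to bound below the probability of a small ball around each point [y] of [U], whose
    exponential cost is close to [I y]. *)
Let LDP_lower (U : set R) : open U ->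
  (- ereal_inf ((EFin \o I) @` U) <= limf_einf (fun k => rho k U) F)%E.
Proof.
move=> oU; rewrite leeNl; apply: le_ereal_inf_tmp => _ [y Uy <-].
rewrite leeNl -EFinN; apply: lee_dense => a; rewrite lte_fin => ay.
apply: limf_einf_ge.
have [e e0 [eU ea]] : exists2 e : R, 0 < e &
    (forall z, `|z - y| < e -> U z) /\ a < - ((`|y| + e) ^+ 2 / (2 * sg2)).
  have lim : - ((`|y| + e) ^+ 2 / (2 * sg2)) @[e --> 0^'+] -->
      - ((`|y| + 0) ^+ 2 / (2 * sg2)).
    apply: cvgN; apply: cvgM; last exact: cvg_cst.
    apply: cvg_sqr; apply: cvgD; first exact: cvg_cst.
    by apply: cvg_at_right_filter; exact: cvg_id.
  have [e0 /= e0p eU] : exists2 e : R, 0 < e & forall z, `|y - z| < e -> U z.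
    have := open_nbhs_nbhs (conj oU Uy) => /nbhs_ballP[e e0 eU].
    by exists e => // z zy; exact: eU.
  near (0:R)^'+ => e; exists e => //; split.
    move=> z zy; apply: eU; rewrite distrC (lt_trans zy)//.
  near: e; apply: (cvgr_gt _ lim); rewrite addr0.
  by move: ay; rewrite /I mulrC -(real_normK (num_real y)).
(* The prefactor of the ball bound at variance 1, which is below the true prefactor once [v k <= 1];
   its logarithm divided by the speed vanishes. *)
pose A := 2 * e / Num.sqrt (2 * pi).
have A0 : 0 < A by rewrite divr_gt0 ?mulr_gt0// sqrtr_gt0 mulr_gt0// pi_gt0.
have lim : (speed k)^-1 * ln A - (`|y| + `|m k| + e) ^+ 2 / (2 * (speed k * v k))
    @[k --> F] --> - ((`|y| + e) ^+ 2 / (2 * sg2)).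
  have -> : - ((`|y| + e) ^+ 2 / (2 * sg2)) =
    0 * ln A - (`|y| + 0 + e) ^+ 2 / (2 * sg2) by rewrite mul0r sub0r addr0.
  apply: cvgB; first by apply: cvgM => //; exact: cvg_cst.
  apply: cvgM.
    apply: cvg_sqr; apply: cvgD; last exact: cvg_cst.
    by apply: cvgD => //; exact: cvg_cst.
  apply: cvgV; first by rewrite mulf_neq0// gt_eqF.
  by apply: cvgM => //; exact: cvg_cst.
near=> k; have s0 : 0 < speed k by near: k; exact: speed_gt0.
apply: log_bound_ge => //.
have [v0 [mZ _ Zl]] : 0 < v k /\ gaussian_bounds P (fun w => Z k w - m k) (v k).
  by near: k; exact: bounds.
have v1 : v k <= 1 by near: k; exact: (cvgr_le _ v_cvg0).
apply: (@le_trans _ _ (P [set w | `|Z k w - m k - (y - m k)| < e])); last first.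
  apply: le_measure; rewrite ?inE.
  - rewrite -[X in measurable X]setTI.
    rewrite (_ : [set w | _] = (fun w => Z k w - m k) @^-1`
      `](y - m k - e), (y - m k + e)[%classic); first exact: mZ.
    by apply/seteqP; split => w; rewrite /= in_itv/= ltr_distl.
  - rewrite -[X in measurable X]setTI.
    have /(_ _ U) : measurable_fun setT (Z k) by near: k; exact: measZ.
    by apply => //; exact: open_measurable.
  - by move=> w /= zw; apply: eU; move: zw; congr (`|_| < _); ring.
apply: le_trans (Zl _ _ e0); rewrite lee_fin.
apply: (@le_trans _ _ (A * expR (- (`|y| + `|m k| + e) ^+ 2 / (2 * v k)))).
  rewrite -{1}(@lnK _ A) ?posrE// -expRD ler_expR -ler_pdivlMl//.
  have -> : (speed k)^-1 * (ln A + - (`|y| + `|m k| + e) ^+ 2 / (2 * v k)) =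
    (speed k)^-1 * ln A - (`|y| + `|m k| + e) ^+ 2 / (2 * (speed k * v k)).
    by field; rewrite !gt_eqF.
  by apply: ltW; near: k; exact: (cvgr_gt _ lim).
apply: ler_pM; rewrite ?(ltW A0) ?expR_ge0//.
  rewrite ler_wpM2l ?mulr_ge0 ?(ltW e0)//.
  rewrite lef_pV2 ?posrE ?sqrtr_gt0 ?mulr_gt0 ?pi_gt0//.
  by rewrite ler_wsqrtr// ler_piMr// mulr_ge0// pi_ge0.
rewrite ler_expR ler_pM2r ?invr_gt0 ?mulr_gt0// lerN2.
rewrite lerXn2r ?nnegrE ?addr_ge0 ?(ltW e0)//.
by rewrite lerD2r// (le_trans (ler_normB _ _)).
Unshelve. all: by end_near. Qed.

(** The filter is abstract so that one statement serves both the discrete means along the integers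
    and the exact means along real times; [m] and [v] stand for mean and variance. *)
Lemma gaussian_LDP : satisfies_LDP P F speed Z (EFin \o I).
Proof.
split=> //.
by have [] := good_rate_quadratic (2 * sg2)^-1; rewrite ?invr_gt0 ?mulr_gt0.
Qed.

End GaussianLDP.

End GaussianLargeDeviations.

(** * The numerical method *)

Section Recurrences.
Context {R : realType}.

Section SecondOrderRecurrence.
Variables (tau : R) (u : nat -> R).
Hypothesis tau_lt2 : tau ^+ 2 < 4.
Hypothesis recu : forall n, u n.+2 = tau * u n.+1 - u n.

(** The initial value of the quadratic form [u n ^+ 2 + u n.+1 ^+ 2 - tau * u n * u n.+1], which the
    recurrence conserves. *)
Definition rec_energy : R := u 0%N ^+ 2 + u 1%N ^+ 2 - tau * u 0%N * u 1%N.

Lemma rec_energyE n : u n ^+ 2 + u n.+1 ^+ 2 - tau * u n * u n.+1 = rec_energy.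
Proof. by elim: n => // n <-; rewrite recu; ring. Qed.

(** Completing the square in [u n.+1] shows that the conserved form dominates
    [(1 - tau ^+ 2 / 4) * u n ^+ 2]. *)
Lemma rec_bounded : exists M, forall n, `|u n| <= M.
Proof.
exists (Num.sqrt (rec_energy / (1 - tau ^+ 2 / 4))) => n.
rewrite -sqrtr_sqr ler_wsqrtr// ler_pdivlMr; last by move: tau_lt2; lra.
rewrite -(rec_energyE n) -subr_ge0.
have -> : u n ^+ 2 + u n.+1 ^+ 2 - tau * u n * u n.+1 -
  u n ^+ 2 * (1 - tau ^+ 2 / 4) = (u n.+1 - tau * u n / 2) ^+ 2 by field.
exact: sqr_ge0.
Qed.

(** Summing the recurrence telescopes; only boundary values remain. *)
Lemma rec_sum n : (2 - tau) * (\sum_(k < n) u k) =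
  (tau - 1) * u n - u n.+1 + (1 - tau) * u 0%N + u 1%N.
Proof.
elim: n => [|n IH]; first by rewrite big_ord0; ring.
by rewrite big_ord_recr/= mulrDr IH recu; ring.
Qed.

(** The conserved form supplies the only term growing with [n]; the others are boundary values,
    bounded by [rec_bounded]. *)
Lemma rec_sum_sqr n : (4 - tau ^+ 2) * (\sum_(k < n) u k ^+ 2) =
  2 * rec_energy * n%:R + (tau ^+ 2 - 2) * (u n ^+ 2 - u 0%N ^+ 2) -
  tau * (u n * u n.+1 - u 0%N * u 1%N).
Proof.
elim: n => [|n IH]; first by rewrite big_ord0; ring.
by rewrite big_ord_recr/= mulrDr IH recu -natr1 -(rec_energyE n); ring.
Qed.

Let bounded_mean (f : nat -> R) : (exists M, forall n, `|f n| <= M) ->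
  n%:R^-1 * f n @[n --> \oo] --> 0.
Proof.
move=> [M fM].
have lim : n%:R^-1 * M @[n --> \oo] --> 0.
  by rewrite -(mul0r M); apply: cvgM; [exact: cvg_invn | exact: cvg_cst].
apply/norm_cvg0P; apply: squeeze_cvgr (cvg_cst 0) lim.
near=> n; rewrite normr_ge0/= normrM ger0_norm ?invr_ge0// ler_wpM2l ?invr_ge0//.
Unshelve. all: by end_near. Qed.

Lemma rec_mean : n%:R^-1 * (\sum_(k < n) u k) @[n --> \oo] --> 0.
Proof.
have [M uM] := rec_bounded.
have t2 : 2 - tau != 0 by apply/eqP => t2; move: tau_lt2; nra.
apply: bounded_mean.
exists (`|2 - tau|^-1 * ((`|tau - 1| + 1 + `|1 - tau| + 1) * M)) => n.
rewrite -[X in `|X|](mulKf t2) normrM normfV ler_wpM2l ?invr_ge0// rec_sum.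
have uM' a k : `|a * u k| <= `|a| * M by rewrite normrM ler_wpM2l.
rewrite ![in leRHS]mulrDl !mul1r (le_trans (ler_normD _ _))// lerD//.
rewrite (le_trans (ler_normD _ _))// lerD//.
by rewrite (le_trans (ler_normB _ _))// lerD.
Qed.

Lemma rec_mean_sqr : n%:R^-1 * (\sum_(k < n) u k ^+ 2) @[n --> \oo] -->
  2 * rec_energy / (4 - tau ^+ 2).
Proof.
have [M uM] := rec_bounded.
have t4 : 4 - tau ^+ 2 != 0 by rewrite gt_eqF// subr_gt0.
pose g n := (4 - tau ^+ 2)^-1 * ((tau ^+ 2 - 2) * (u n ^+ 2 - u 0%N ^+ 2) -
  tau * (u n * u n.+1 - u 0%N * u 1%N)).
have gM : exists M', forall n, `|g n| <= M'.
  have uuM i j : `|u i * u j| <= M * M by rewrite normrM ler_pM.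
  exists (`|4 - tau ^+ 2|^-1 * (`|tau ^+ 2 - 2| * (M * M + M * M) +
    `|tau| * (M * M + M * M))) => n.
  rewrite /g normrM normfV ler_wpM2l ?invr_ge0//.
  have uuM' a i j k l : `|a * (u i * u j - u k * u l)| <= `|a| * (M * M + M * M).
    by rewrite normrM ler_wpM2l// (le_trans (ler_normB _ _))// lerD.
  by rewrite !expr2 (le_trans (ler_normB _ _))// lerD.
have : 2 * rec_energy / (4 - tau ^+ 2) + n%:R^-1 * g n @[n --> \oo] -->
    2 * rec_energy / (4 - tau ^+ 2) + 0.
  by apply: cvgD; [exact: cvg_cst | exact: bounded_mean].
rewrite addr0; apply: cvg_trans; apply: near_eq_cvg; near=> n.
have n0 : n%:R != 0 :> R by rewrite pnatr_eq0 -lt0n; near: n; exact: nbhs_infty_gt.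
rewrite -[X in _ = _ * X](mulKf t4) rec_sum_sqr /g; field.
by rewrite n0 t4.
Unshelve. all: by end_near. Qed.

End SecondOrderRecurrence.

(** When the square is expanded, the cross term is a multiple of the mean of [q], which tends to
    0. *)
Lemma rec_mean_shift_sqr (tau : R) (q : nat -> R) (p : R) : tau ^+ 2 < 4 ->
  (forall n, q n.+2 = tau * q n.+1 - q n) ->
  n%:R^-1 * (\sum_(k < n) (p - q k) ^+ 2) @[n --> \oo] -->
  p ^+ 2 + 2 * rec_energy tau q / (4 - tau ^+ 2).
Proof.
move=> tau2 recq.
have : p ^+ 2 - 2 * p * (n%:R^-1 * (\sum_(k < n) q k)) +
    n%:R^-1 * (\sum_(k < n) q k ^+ 2) @[n --> \oo] -->
    p ^+ 2 - 2 * p * 0 + 2 * rec_energy tau q / (4 - tau ^+ 2).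
  apply: cvgD; last exact: rec_mean_sqr.
  apply: cvgB; first exact: cvg_cst.
  by apply: cvgM; [exact: cvg_cst | exact: rec_mean tau2 recq].
rewrite mulr0 subr0; apply: cvg_trans; apply: near_eq_cvg; near=> n.
have n0 : n%:R != 0 :> R by rewrite pnatr_eq0 -lt0n; near: n; exact: nbhs_infty_gt.
have -> : \sum_(k < n) (p - q k) ^+ 2 =
    n%:R * p ^+ 2 - 2 * p * (\sum_(k < n) q k) + \sum_(k < n) q k ^+ 2.
  elim: (n) => [|m IH]; first by rewrite !big_ord0; ring.
  by rewrite !big_ord_recr/= IH -natr1; ring.
by field.
Unshelve. all: by end_near. Qed.

End Recurrences.

(** * Explicit solution of the numerical recursion *)

Section LinearMethod.
Context {R : realType}.

Section NumericalSolution.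
Context d (Omega : measurableType d).
Variables (A : 'M[R]_2) (b z : 'cV[R]_2) (alpha h : R) (W : R -> Omega -> R).

Definition geom_mx (m : nat) : 'M[R]_2 := \sum_(j < m) A ^+ j.

Let exprmxS n : A *m A ^+ n = A ^+ n.+1. Proof. by rewrite exprS. Qed.

Lemma numsolE n w : numsol A b alpha h W z n w = A ^+ n *m z +
  alpha *: \sum_(k < n) increment W (k%:R * h) (k.+1%:R * h) w *:
    (A ^+ (n - k.+1) *m b).
Proof.
elim: n => [|n IH]; first by rewrite big_ord0 scaler0 addr0 expr0 mul1mx.
rewrite /= IH mulmxDr big_ord_recr/= subnn expr0 mul1mx scalerDr addrA.
rewrite -scalemxAr mulmx_sumr mulmxA exprmxS scalerA; congr (_ + _ *: _ + _).
apply: eq_bigr => k _; rewrite -scalemxAr mulmxA exprmxS.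
by rewrite -subSn// ltn_ord.
Qed.

(** The increment of index [k] first acts at step [k.+1] and is propagated up to step [N - 1], so
    [N - k.+1] successive powers of [A] accumulate, none for the last increment. *)
Lemma sum_numsol N w : \sum_(n < N) numsol A b alpha h W z n w = geom_mx N *m z +
  alpha *: \sum_(k < N) increment W (k%:R * h) (k.+1%:R * h) w *:
    (geom_mx (N - k.+1) *m b).
Proof.
elim: N => [|N IH].
  by rewrite !big_ord0 scaler0 addr0 /geom_mx big_ord0 mul0mx.
rewrite big_ord_recr/= IH numsolE addrACA -mulmxDl -scalerDr -big_split/=.
rewrite [in RHS]big_ord_recr/= subnn /geom_mx big_ord0 mul0mx scaler0 addr0.
congr (_ + _); first by rewrite big_ord_recr.
congr (_ *: _); apply: eq_bigr => k _.
by rewrite -scalerDr -mulmxDl subSn ?ltn_ord// big_ord_recr.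
Qed.

Lemma discrete_meanE N w : discrete_mean A b alpha h W z N w =
  N%:R^-1 * (\sum_(k < N) (A ^+ k *m z) 0 0) +
  N%:R^-1 * alpha * grid_sum W h (fun k => (geom_mx (N - k.+1) *m b) 0 0) N w.
Proof.
rewrite /discrete_mean /num_x -summxE sum_numsol mxE mulrDr; congr (_ + _).
  by rewrite /geom_mx mulmx_suml summxE.
rewrite mxE mulrA; congr (_ * _); rewrite /grid_sum summxE.
by apply: eq_bigr => k _; rewrite mxE mulrC.
Qed.

End NumericalSolution.

Section TwoByTwo.
Variable A : 'M[R]_2.

Lemma tr_mx22 : \tr A = A 0 0 + A 1 1.
Proof.
rewrite /mxtrace !big_ord_recl big_ord0 addr0.
by congr (_ + A _ _); apply/val_inj.
Qed.

Lemma det_mx22 : \det A = A 0 0 * A 1 1 - A 0 1 * A 1 0.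
Proof.
rewrite (expand_det_row _ 0) !big_ord_recl big_ord0 addr0.
rewrite /cofactor !det_mx11 !mxE/= expr0 mul1r expr1 mulN1r mulrN.
by congr (A _ _ * A _ _ - A _ _ * A _ _); apply/val_inj.
Qed.

Lemma mul_mx2E (B : 'M[R]_2) (x : 'cV[R]_2) i :
  (B *m x) i 0 = B i 0 * x 0 0 + B i 1 * x 1 0.
Proof.
rewrite mxE !big_ord_recl big_ord0 addr0.
by congr (_ + B _ _ * x _ _); apply/val_inj.
Qed.

Hypothesis detA : \det A = 1.

(** With determinant 1 the characteristic equation reads [A ^+ 2 = \tr A *: A - 1]. *)
Lemma Cayley_Hamilton22 (x : 'cV[R]_2) n :
  (A ^+ n.+2 *m x) 0 0 = \tr A * (A ^+ n.+1 *m x) 0 0 - (A ^+ n *m x) 0 0.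
Proof.
have -> : A ^+ n.+2 = A *m (A *m A ^+ n) by rewrite !exprS.
rewrite exprS -!mulmxA; set y := A ^+ n *m x; rewrite !mul_mx2E tr_mx22.
move: detA; rewrite det_mx22 => dA.
rewrite -[X in _ - X]mul1r -dA; ring.
Qed.

End TwoByTwo.

End LinearMethod.

(** * Large deviations of the discrete mean position *)

Section LinearMethodLDP.
Context {R : realType}.

Section DiscreteMeanLDP.
Variables (A : 'M[R]_2) (b : 'cV[R]_2) (alpha h : R).
Hypothesis alpha0 : 0 < alpha.
Hypothesis h0 : 0 < h.
Hypothesis hb : nonzero_noise b.
Hypothesis hA1 : condA1 A.
Hypothesis hA2 : condA2 A.

Local Notation tau := (\tr A).
Local Notation b1 := (b 0 0).
Local Notation beta := (A 0 1 * b 1 0 - A 1 1 * b 0 0).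

Let tau2 : tau ^+ 2 < 4.
Proof. by move: hA1; rewrite /condA1 hA2 mulr1 subr_gt0. Qed.

Let tau_lt2 : 0 < 2 - tau. Proof. by move: tau2; nra. Qed.

Let tau_gtN2 : 0 < 2 + tau. Proof. by move: tau2; nra. Qed.

Definition mean_coef (m : nat) : R := (geom_mx A m *m b) 0 0.

(** The fixed point of the affine recurrence [mean_coef_rec]; the coefficients oscillate around it
    and in general tend to it only in average. *)
Definition mean_coef_limit : R := (b1 + beta) / (2 - tau).

Definition mean_coef_dev (m : nat) : R := mean_coef_limit - mean_coef m.

Let coefS m : mean_coef m.+1 = mean_coef m + (A ^+ m *m b) 0 0.
Proof. by rewrite /mean_coef /geom_mx big_ord_recr/= mulmxDl mxE. Qed.

Lemma mean_coef0 : mean_coef 0 = 0.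
Proof. by rewrite /mean_coef /geom_mx big_ord0 mul0mx mxE. Qed.

Lemma mean_coef1 : mean_coef 1 = b1.
Proof. by rewrite coefS mean_coef0 expr0 mul1mx add0r. Qed.

Lemma mean_coef_rec m :
  mean_coef m.+2 = tau * mean_coef m.+1 - mean_coef m + (b1 + beta).
Proof.
elim: m => [|m IH].
  rewrite (coefS 1) mean_coef1 mean_coef0 expr1 mul_mx2E tr_mx22; ring.
rewrite (coefS m.+2) {1}IH (coefS m.+1) (Cayley_Hamilton22 _ hA2) (coefS m).
ring.
Qed.

Lemma mean_coef_dev_rec m :
  mean_coef_dev m.+2 = tau * mean_coef_dev m.+1 - mean_coef_dev m.
Proof.
rewrite /mean_coef_dev mean_coef_rec /mean_coef_limit.
by field; rewrite gt_eqF.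
Qed.

(** The limit of [N] times the variance of the discrete mean: the last factor is the squared average
    of the weights plus the mean square of their oscillation. *)
Definition mean_variance : R := alpha ^+ 2 * h *
  (mean_coef_limit ^+ 2 + 2 * rec_energy tau mean_coef_dev / (4 - tau ^+ 2)).

(** If it vanished, [mean_coef_limit] and the energy would both be 0, forcing [b1 = 0] and then
    [A 0 1 * b 1 0 = 0]. The discriminant condition excludes [A 0 1 = 0], so [b] would be zero. *)
Lemma mean_variance_gt0 : 0 < mean_variance.
Proof.
have A010 : A 0 1 != 0.
  apply/eqP => a0; move: hA1; rewrite /condA1 det_mx22 tr_mx22 a0.
  have -> : 4 * (A 0 0 * A 1 1 - 0 * A 1 0) - (A 0 0 + A 1 1) ^+ 2 =
    - (A 0 0 - A 1 1) ^+ 2 by ring.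
  by rewrite oppr_gt0 ltNge sqr_ge0.
have t4 : 0 < 4 - tau ^+ 2 by rewrite subr_gt0.
have QE : rec_energy tau mean_coef_dev = mean_coef_dev 0 ^+ 2 * (1 - tau ^+ 2 / 4)
  + (mean_coef_dev 1 - tau * mean_coef_dev 0 / 2) ^+ 2.
  by rewrite /rec_energy; field.
have Q0 : 0 <= rec_energy tau mean_coef_dev.
  by rewrite QE addr_ge0 ?sqr_ge0// mulr_ge0 ?sqr_ge0//; move: tau2; lra.
rewrite mulr_gt0 ?mulr_gt0 ?exprn_gt0// lt0r addr_ge0 ?sqr_ge0// ?andbT; last first.
  by rewrite divr_ge0 ?mulr_ge0// ltW.
apply/negP; rewrite paddr_eq0 ?sqr_ge0//; last by rewrite divr_ge0 ?mulr_ge0// ltW.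
rewrite sqrf_eq0 => /andP[/eqP p0].
rewrite mulf_eq0 mulf_eq0 invr_eq0 (gt_eqF t4) orbF pnatr_eq0/= => /eqP Qeq0.
move: QE; rewrite Qeq0 /mean_coef_dev p0 mean_coef0 mean_coef1 => QE.
have b10 : b1 = 0.
  apply/eqP; rewrite -sqrf_eq0; apply/eqP; rewrite [RHS]QE; ring.
move: p0; rewrite /mean_coef_limit b10 mulr0 subr0 add0r => /eqP.
rewrite mulf_eq0 invr_eq0 (gt_eqF tau_lt2) orbF mulf_eq0 (negbTE A010)/= => /eqP b20.
by move: hb; rewrite /nonzero_noise b10 b20 !expr0n/= addr0 eqxx.
Qed.

(** Up to the positive factors [(2 - tau) ^+ 2 * (2 + tau)] and [alpha ^+ 2 * h], the bracket in the
    denominator of [rate_h] is [mean_variance]; in particular it does not vanish. *)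
Lemma rate_hE : rate_h A b alpha h = (fun y => (2 * mean_variance)^-1 * y ^+ 2).
Proof.
apply/funext => y; rewrite /rate_h/=.
set B := (X in _ / (_ * X)).
have BE : mean_variance * ((2 - tau) ^+ 2 * (2 + tau)) = alpha ^+ 2 * h * B.
  rewrite /mean_variance /rec_energy /mean_coef_dev mean_coef0 mean_coef1.
  rewrite /mean_coef_limit /B.
  rewrite (_ : 4 - tau ^+ 2 = (2 - tau) * (2 + tau)); last by ring.
  by field; rewrite !gt_eqF.
have B0 : B != 0.
  have : mean_variance * ((2 - tau) ^+ 2 * (2 + tau)) != 0.
    by rewrite gt_eqF// mulr_gt0 ?mean_variance_gt0// mulr_gt0 ?exprn_gt0.
  by rewrite BE mulf_eq0 negb_or => /andP[].
have -> : mean_variance = alpha ^+ 2 * h * B / ((2 - tau) ^+ 2 * (2 + tau)).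
  by rewrite -BE mulfK// mulf_neq0// ?expf_neq0// gt_eqF.
by field; rewrite B0 !gt_eqF.
Qed.

Lemma good_rate_h : good_rate_function (EFin \o rate_h A b alpha h).
Proof.
rewrite rate_hE; apply: good_rate_quadratic.
by rewrite invr_gt0 mulr_gt0// mean_variance_gt0.
Qed.

Lemma mean_coef_sqr_cvg :
  n%:R^-1 * (\sum_(k < n) mean_coef (n - k.+1) ^+ 2) @[n --> \oo] -->
  mean_variance / (alpha ^+ 2 * h).
Proof.
have -> : mean_variance / (alpha ^+ 2 * h) =
    mean_coef_limit ^+ 2 + 2 * rec_energy tau mean_coef_dev / (4 - tau ^+ 2).
  by rewrite /mean_variance mulrC mulKf// mulf_neq0 ?expf_neq0// gt_eqF.
have := rec_mean_shift_sqr _ _ mean_coef_limit tau2 mean_coef_dev_rec.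
apply: cvg_trans; apply: near_eq_cvg; near=> n; congr (_ * _).
(* Reading the increments backwards turns the weight index [n - k.+1] into [k]. *)
rewrite [LHS](reindex_inj rev_ord_inj)/=; apply: eq_bigr => k _.
by rewrite /mean_coef_dev subKr.
Unshelve. all: by end_near. Qed.

Lemma discrete_mean_LDP d (Omega : measurableType d) (P : probability Omega R)
    (F : R -> set (set Omega)) (W : R -> Omega -> R) (z : 'cV[R]_2) :
  complete_filtration P F -> standard_brownian_motion P F W ->
  satisfies_LDP P \oo (fun N : nat => N%:R)
    (discrete_mean A b alpha h W z) (EFin \o rate_h A b alpha h).
Proof.
move=> hF hW; rewrite rate_hE.
have a2h0 : 0 < alpha ^+ 2 * h by rewrite mulr_gt0// exprn_gt0.
pose m N : R := N%:R^-1 * (\sum_(k < N) (A ^+ k *m z) 0 0).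
pose s N : R := \sum_(k < N) mean_coef (N - k.+1) ^+ 2.
pose v N : R := (N%:R^-1 * alpha) ^+ 2 * (h * s N).
have s_cvg := mean_coef_sqr_cvg.
apply: (gaussian_LDP _ _ P _ _ _ _ m v).
- exact: mean_variance_gt0.
- exact: cvgr_idn.
(* The noise-free positions obey the same recurrence, so the contribution of the starting point
   averages to 0. *)
- exact: (rec_mean _ (fun k => (A ^+ k *m z) 0 0) tau2 (Cayley_Hamilton22 _ hA2 z)).
- have : alpha ^+ 2 * h * (n%:R^-1 * s n) @[n --> \oo] -->
      alpha ^+ 2 * h * (mean_variance / (alpha ^+ 2 * h)).
    by apply: cvgM => //; exact: cvg_cst.
  rewrite mulrCA divff ?gt_eqF// mulr1.
  apply: cvg_trans; apply: near_eq_cvg; near=> n.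
  have n0 : n%:R != 0 :> R by rewrite pnatr_eq0 -lt0n; near: n; exact: nbhs_infty_gt.
  by rewrite /v; field.
near=> N.
have N0 : 0 < N%:R :> R by rewrite ltr0n; near: N; exact: nbhs_infty_gt.
have sN : 0 < s N.
  have : 0 < N%:R^-1 * s N.
    near: N; apply: (cvgr_gt _ s_cvg).
    by rewrite divr_gt0// mean_variance_gt0.
  by rewrite pmulr_rgt0// invr_gt0.
split; first by rewrite mulr_gt0 ?exprn_gt0 ?mulr_gt0 ?invr_gt0.
rewrite (_ : (fun w => _) = (fun w => N%:R^-1 * alpha *
    grid_sum W h (fun k => mean_coef (N - k.+1)) N w)).
  apply: gaussian_boundsZ; rewrite ?mulr_gt0 ?mulf_neq0 ?invr_eq0 ?gt_eqF//.
  apply: normal_law_bounds; first by rewrite mulr_gt0.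
    exact: (measurable_grid_sum hF hW h0).
  by move=> B mB; apply: (grid_sum_law hF hW h0).
by apply/funext => w; rewrite discrete_meanE /m addrC addKr.
Unshelve. all: by end_near. Qed.

End DiscreteMeanLDP.

End LinearMethodLDP.

(** * The exact solution *)

Section RiemannStieltjes.
Context {R : realType}.

Lemma within_continuousB (A : set R) (f g : R -> R) : {within A, continuous f} ->
  {within A, continuous g} -> {within A, continuous (fun x => f x - g x)}.
Proof.
move=> /subspace_continuousP cf /subspace_continuousP cg.
by apply/subspace_continuousP => x Ax; apply: cvgB; [exact: cf | exact: cg].
Qed.

Lemma within_continuousM (A : set R) (f g : R -> R) : {within A, continuous f} ->
  {within A, continuous g} -> {within A, continuous (fun x => f x * g x)}.
Proof.
move=> /subspace_continuousP cf /subspace_continuousP cg.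
by apply/subspace_continuousP => x Ax; apply: cvgM; [exact: cf | exact: cg].
Qed.

(** Compactness is used in its near-covering form, the modulus [d] ranging over the filter
    [0^'+]. *)
Lemma uniform_continuity_segment (a b : R) (f : R -> R) (e : R) :
  {within `[a, b], continuous f} -> 0 < e ->
  exists2 d : R, 0 < d & forall x y, x \in `[a, b] -> y \in `[a, b] ->
    `|x - y| < d -> `|f x - f y| < e.
Proof.
move=> cf e0; have e20 : 0 < e / 2 by rewrite divr_gt0.
have /compact_near_coveringP := @segment_compact _ a b.
move=> /(_ R (0:R)^'+ (fun d x => x \in `[a, b] -> forall y, y \in `[a, b] ->
    `|x - y| < d -> `|f x - f y| < e)) cov.
have : \forall d \near (0:R)^'+, `[a, b]%classic `<=` (fun x => x \in `[a, b] ->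
    forall y, y \in `[a, b] -> `|x - y| < d -> `|f x - f y| < e).
  apply: cov => x xab.
  have [r /= r0 rf] : exists2 r : R, 0 < r & forall y, y \in `[a, b] ->
      `|x - y| < r -> `|f x - f y| < e / 2.
    move/subspace_continuousP : cf => /(_ x xab) /cvgrPdist_lt /(_ _ e20).
    move=> /nbhs_ballP[r r0 rP].
    by exists r => // y yab xy; apply: rP.
  have r20 : 0 < r / 2 by rewrite divr_gt0.
  (* Halving [r] keeps both [x'] and [y] within [r] of the centre [x]. *)
  exists (ball x (r / 2), [set d | d < r / 2]) => /=.
    by split; [exact: nbhsx_ballx | exact: nbhs_right_lt].
  move=> [x' d] /= [xx' dr] x'ab y yab x'y.
  have h1 : `|f x - f x'| < e / 2.
    have {}xx' : `|x - x'| < r / 2 by exact: xx'.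
    by apply: rf => //; lra.
  have h2 : `|f x - f y| < e / 2.
    apply: rf => //; rewrite [r]splitr (le_lt_trans (ler_distD x' _ _))// ltrD//.
    exact: lt_trans dr.
  rewrite [e]splitr (le_lt_trans (ler_distD (f x) _ _))// ltrD//.
  by rewrite distrC.
move=> unif; near (0:R)^'+ => d; exists d => // x y xab yab; move: x xab y yab.
by near: d; apply: filterS unif => d h x xab y yab; exact: h.
Unshelve. all: by end_near. Qed.

(* Each summand is compared with the increment of psi by the mean value
   theorem applied to psi - f (s_k) C. *)
Lemma riemann_stieltjes_cvg (T M : R) (f C g psi : R -> R) : 0 < T ->
  {within `[0, T], continuous f} ->
  {within `[0, T], continuous C} -> {within `[0, T], continuous psi} ->
  (forall s, s \in `]0, T[ -> is_derive s 1 C (g s)) ->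
  (forall s, s \in `]0, T[ -> is_derive s 1 psi (f s * g s)) ->
  (forall s, `|g s| <= M) ->
  \sum_(k < n) f (k%:R * (T / n%:R)) *
    (C (k.+1%:R * (T / n%:R)) - C (k%:R * (T / n%:R))) @[n --> \oo] -->
  psi T - psi 0.
Proof.
move=> T0 cf cC cpsi dC dpsi gM.
have M0 : 0 <= M by apply: le_trans (gM 0).
apply/cvgrPdist_le => e e0.
(* The errors of the [n] steps add up to at most [e' * M * T]; [M + 1] replaces [M] to allow
   [M = 0]. *)
pose e' := e / (T * (M + 1)).
have TM0 : 0 < T * (M + 1) by rewrite mulr_gt0// ltr_wpDl.
have e'0 : 0 < e' by rewrite divr_gt0.
have dcvg : T / n%:R @[n --> \oo] --> 0.
  by rewrite -(mulr0 T); apply: cvgM; [exact: cvg_cst | exact: cvg_invn].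
have [d' d'0 fd] := uniform_continuity_segment _ _ _ _ cf e'0.
near=> n.
have dd' : T / n%:R < d' by near: n; exact: (cvgr_lt _ dcvg).
have n0 : 0 < n%:R :> R by rewrite ltr0n; near: n; exact: nbhs_infty_gt.
set d := T / n%:R.
have d0 : 0 < d by rewrite divr_gt0.
have unif x y : x \in `[0, T] -> y \in `[0, T] -> `|x - y| < d -> `|f x - f y| < e'.
  by move=> xT yT xy; apply: fd => //; exact: lt_trans dd'.
have nd : n%:R * d = T by rewrite /d mulrC divfK// gt_eqF.
have grid k : (k <= n)%N -> k%:R * d \in `[0, T].
  move=> kn; rewrite in_itv/= mulr_ge0 ?(ltW d0)//= -nd ler_pM2r// ler_nat//.
have step k : (k < n)%N ->
    `|(psi (k.+1%:R * d) - psi (k%:R * d)) -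
      f (k%:R * d) * (C (k.+1%:R * d) - C (k%:R * d))| <= e' * M * d.
  move=> kn; pose G s := psi s - f (k%:R * d) * C s.
  have := grid _ kn; have := grid _ (ltnW kn).
  rewrite !in_itv/= => /andP[k0 kT] /andP[k10 k1T].
  have sub s : s \in `](k%:R * d), (k.+1%:R * d)[ -> s \in `]0, T[.
    rewrite !in_itv/= => /andP[ks sk]; rewrite (le_lt_trans k0 ks)/=.
    exact: lt_le_trans sk k1T.
  have dG s : s \in `](k%:R * d), (k.+1%:R * d)[ ->
      is_derive s 1 G ((f s - f (k%:R * d)) * g s).
    move=> /sub sT; have dC' := dC _ sT; have dpsi' := dpsi _ sT.
    apply: (is_derive_eq (is_deriveB dpsi' (is_deriveZ (f (k%:R * d)) dC'))).
    by rewrite mulrBl.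
  have cG : {within `[(k%:R * d), (k.+1%:R * d)], continuous G}.
    have sub' : `[(k%:R * d), (k.+1%:R * d)] `<=` `[0, T].
      move=> s /=; rewrite !in_itv/= => /andP[ks sk].
      by rewrite (le_trans k0 ks)/= (le_trans sk).
    have cpsi' := continuous_subspaceW sub' cpsi.
    have cC' := continuous_subspaceW sub' cC.
    apply: within_continuousB => //; apply: within_continuousM => //.
    by apply: continuous_subspaceT => x; exact: cvg_cst.
  have [|c cI cE] := MVT _ dG cG.
    by rewrite ltr_pM2r// ltr_nat.
  have -> : (psi (k.+1%:R * d) - psi (k%:R * d)) -
      f (k%:R * d) * (C (k.+1%:R * d) - C (k%:R * d)) =
      G (k.+1%:R * d) - G (k%:R * d) by rewrite /G; ring.
  rewrite cE -mulrBl -natr1 (addrC k%:R) addrK mul1r.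
  rewrite normrM (gtr0_norm d0) ler_pM2r// normrM.
  apply: ler_pM => //; apply: ltW; apply: unif.
  - by have /andP[? ?] := sub _ cI; rewrite in_itv/=; apply/andP; split; apply: ltW.
  - exact: grid (ltnW kn).
  - move: cI; rewrite in_itv/= -natr1 mulrDl mul1r => /andP[c1 c2].
    by rewrite gtr0_norm ?subr_gt0// ltrBlDl.
have tele : psi T - psi 0 = \sum_(k < n) (psi (k.+1%:R * d) - psi (k%:R * d)).
  by rewrite -(big_mkord xpredT (fun k => psi (k.+1%:R * d) - psi (k%:R * d)))
    telescope_sumr// nd mul0r.
rewrite tele -sumrB (le_trans (ler_norm_sum _ _ _))//.
rewrite (@le_trans _ _ (\sum_(k < n) e' * M * d))//.
  by apply: ler_sum => k _; exact: step.
rewrite sumr_const card_ord -mulr_natr -mulrA (mulrC d) nd.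
have -> : e = e' * (M + 1) * T by rewrite /e' -mulrA (mulrC _ T) divfK// gt_eqF.
by rewrite ler_pM2r// ler_pM2l// lerDl.
Unshelve. all: by end_near. Qed.

End RiemannStieltjes.

(** * The integral of an oscillator path as a limit of noise sums *)

Section Oscillator.
Context {R : realType}.
Local Notation mu := (@lebesgue_measure R).

Section OscillatorPath.
Variables (X Y w : R -> R) (alpha x0 y0 T : R).
Hypothesis T0 : 0 < T.
Hypothesis cX : {within `[0, +oo[, continuous X}.
Hypothesis cY : {within `[0, +oo[, continuous Y}.
Hypothesis cw : {within `[0, +oo[, continuous w}.
Hypothesis w0 : w 0 = 0.
Hypothesis sol : forall t : R, 0 <= t ->
  X t = x0 + \int[lebesgue_measure]_(s in `[0, t]) Y s /\
  Y t = y0 - \int[lebesgue_measure]_(s in `[0, t]) X s + alpha * (w t - w 0).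

Let I (f : R -> R) (t : R) : R := \int[lebesgue_measure]_(s in `[0, t]) f s.

Let sub0T : `[0, T] `<=` `[0, +oo[.
Proof. by move=> s /=; rewrite !in_itv/= andbT => /andP[]. Qed.

Let integrable_path (f : R -> R) : {within `[0, +oo[, continuous f} ->
  mu.-integrable `[0, T] (EFin \o f).
Proof.
move=> cf; apply: continuous_compact_integrable; first exact: segment_compact.
exact: continuous_subspaceW sub0T cf.
Qed.

Let is_derive_I (f : R -> R) (s : R) : {within `[0, +oo[, continuous f} ->
  s \in `]0, T[ -> is_derive s 1 (I f) (f s).
Proof.
move=> cf; rewrite in_itv/= => /andP[s0 sT].
have cfs : {for s, continuous f}.
  have /(continuous_within_itvP _ T0)[+ _ _] := continuous_subspaceW sub0T cf.
  by apply; rewrite in_itv/= s0.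
have [dI dE] := continuous_FTC1_closed sT (integrable_path _ cf) s0 cfs.
by rewrite derive1E in dE; exact: (DeriveDef dI dE).
Qed.

Let continuous_I (f : R -> R) : {within `[0, +oo[, continuous f} ->
  {within `[0, T], continuous (I f)}.
Proof.
move=> cf; apply: parameterized_integral_continuous; first exact: ltW.
exact: integrable_path.
Qed.

Let is_derive_sinB (s : R) : is_derive s 1 (fun s => sin (T - s)) (- cos (T - s)).
Proof.
have dB : is_derive s 1 (fun s => T - s) (- 1 : R).
  by apply: is_derive_eq; ring.
by apply: (is_derive_eq (is_derive1_comp (is_derive_sin _) dB)); rewrite mulrN1.
Qed.

Let is_derive_cosB (s : R) : is_derive s 1 (fun s => cos (T - s)) (sin (T - s)).
Proof.
have dB : is_derive s 1 (fun s => T - s) (- 1 : R).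
  by apply: is_derive_eq; ring.
by apply: (is_derive_eq (is_derive1_comp (is_derive_cos _) dB));
  rewrite mulrN1 opprK.
Qed.

Let I0 (f : R -> R) : I f 0 = 0.
Proof. by rewrite /I set_itv1 Rintegral_set1. Qed.

(** Here [x0 + I Y s] is [X s] and [y0 - I X s] is [Y s] without its noise term; as integrals of
    continuous paths both are differentiable. At [s = T] the sine vanishes and [I X T] is
    isolated. *)
Let psi (s : R) : R := (x0 + I Y s) * sin (T - s) - (y0 - I X s) * cos (T - s).

Let is_derive_psi (s : R) : s \in `]0, T[ ->
  is_derive s 1 psi (alpha * w s * sin (T - s)).
Proof.
move=> sT; have dX := is_derive_I _ _ cX sT; have dY := is_derive_I _ _ cY sT.
have := sT; rewrite in_itv/= => /andP[s0 _].
have [Xs Ys] := sol _ (ltW s0).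
have dx : is_derive s 1 (fun s => x0 + I Y s) (Y s).
  by apply: is_derive_eq; ring.
have dy : is_derive s 1 (fun s => y0 - I X s) (- X s).
  by apply: is_derive_eq; ring.
apply: (is_derive_eq (is_deriveB (is_deriveM dx (is_derive_sinB s))
  (is_deriveM dy (is_derive_cosB s)))).
change ((x0 + I Y s) * (- cos (T - s)) + sin (T - s) * Y s -
  ((y0 - I X s) * sin (T - s) + cos (T - s) * (- X s)) = alpha * w s * sin (T - s)).
rewrite Xs Ys w0 /I; ring.
Qed.

Let continuous_psi : {within `[0, T], continuous psi}.
Proof.
have csin : {within `[0, T], continuous (fun s : R => sin (T - s))}.
  by apply: continuous_subspaceT => s; apply: differentiable_continuous;
    apply/derivable1_diffP; have [] := is_derive_sinB s.
have ccos : {within `[0, T], continuous (fun s : R => cos (T - s))}.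
  by apply: continuous_subspaceT => s; apply: differentiable_continuous;
    apply/derivable1_diffP; have [] := is_derive_cosB s.
have ccst (c : R) : {within `[0, T], continuous (fun _ : R => c)}.
  by apply: continuous_subspaceT => s; exact: cvg_cst.
have cI (f : R -> R) : {within `[0, +oo[, continuous f} ->
    {within `[0, T], continuous (I f)}.
  exact: continuous_I.
apply: within_continuousB; apply: within_continuousM => //.
  rewrite (_ : (fun x => _) = (fun s => x0 - (0 - I Y s))).
    by do 2 apply: within_continuousB => //; exact: cI.
  by apply/funext => s; rewrite sub0r opprK.
by apply: within_continuousB => //; exact: cI.
Qed.

(** Summation by parts, to move the differences from the cosines onto the Brownian path. *)
Let abel_sum (u C : nat -> R) n :
  \sum_(k < n) u k * (C k.+1 - C k) =
  u n * C n - u 0%N * C 0%N - \sum_(k < n) C k.+1 * (u k.+1 - u k).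
Proof.
elim: n => [|n IH]; first by rewrite !big_ord0; ring.
by rewrite !big_ord_recr/= IH; ring.
Qed.

Lemma oscillator_mean_cvg :
  alpha * (\sum_(k < n) (1 - cos ((n - k.+1)%:R * (T / n%:R))) *
    (w (k.+1%:R * (T / n%:R)) - w (k%:R * (T / n%:R)))) @[n --> \oo] -->
  I X T - (y0 + x0 * sin T - y0 * cos T).
Proof.
have cw' : {within `[0, T], continuous (fun s : R => alpha * w s)}.
  apply: within_continuousM; last exact: continuous_subspaceW sub0T cw.
  by apply: continuous_subspaceT => s; exact: cvg_cst.
have ccos : {within `[0, T], continuous (fun s : R => cos (T - s))}.
  by apply: continuous_subspaceT => s; apply: differentiable_continuous;
    apply/derivable1_diffP; have [] := is_derive_cosB s.
have := riemann_stieltjes_cvg T 1 _ _ (fun s => sin (T - s)) _ T0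
  cw' ccos continuous_psi
  (fun s _ => is_derive_cosB s) is_derive_psi (fun s => sin_max (T - s)).
have -> : psi T - psi 0 = I X T - (y0 + x0 * sin T - y0 * cos T).
  by rewrite /psi !I0 subrr sin0 cos0 subr0; ring.
apply: cvg_trans; apply: near_eq_cvg; near=> n.
have n0 : n%:R != 0 :> R by rewrite pnatr_eq0 -lt0n; near: n; exact: nbhs_infty_gt.
set dl := T / n%:R; have nd : n%:R * dl = T by rewrite /dl; field.
rewrite (abel_sum (fun k => alpha * w (k%:R * dl)) (fun k => cos (T - k%:R * dl))).
(* The boundary term at [n] carries the cosine of 0 and equals [alpha * w T]; the one at 0 vanishes
   with [w 0]. *)
rewrite nd subrr cos0 mul0r w0 mulr0 mul0r subr0 mulr1 mulr_sumr.
pose u k := alpha * w (k%:R * dl).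
(* Written as a telescoping sum, [alpha * w T] provides the 1 in the weights. *)
have -> : alpha * w T = \sum_(k < n) (u k.+1 - u k).
  rewrite -(big_mkord xpredT (fun k => u k.+1 - u k)) telescope_sumr//.
  by rewrite /u nd mul0r w0 mulr0 subr0.
rewrite -sumrB; apply: eq_bigr => k _.
have -> : (n - k.+1)%:R * dl = T - k.+1%:R * dl by rewrite natrB// mulrBl nd.
by rewrite /u; ring.
Unshelve. all: by end_near. Qed.

End OscillatorPath.

End Oscillator.

(** * Passage of Gaussian bounds to almost sure limits *)

Section GaussianLimits.
Context {R : realType}.

Section GaussianBoundsLimit.
Context d (Omega : measurableType d) (P : probability Omega R).

(** Up to a null set, [E] lies in the increasing union of the tail intersections of the [A n]. Each
    tail intersection has probability at most every late [b_ n], hence at most [b], and continuity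
    from below concludes. *)
Lemma prob_le_liminf (E : set Omega) (A : nat -> set Omega)
    (b_ : nat -> R) (b : R) :
  measurable E ->
  (\forall n \near \oo, measurable (A n) /\ (P (A n) <= (b_ n)%:E)%E) ->
  b_ n @[n --> \oo] --> b ->
  {ae P, forall w, E w -> \forall n \near \oo, A n w} ->
  (P E <= b%:E)%E.
Proof.
move=> mE [n0 _ Ab] bcvg [N [mN N0 NE]].
(* The shift by [n0] restricts to indices where [A n] is measurable with probability at most
   [b_ n]. *)
pose B m := \bigcap_(n in [set n | (n0 + m <= n)%N]) A n.
have mB m : measurable (B m).
  apply: bigcap_measurable => [|n /= mn]; first by exists (n0 + m)%N => /=.
  by have [] := Ab n (leq_trans (leq_addr _ _) mn).
have Bb m : (P (B m) <= b%:E)%E.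
  have PBfin : P (B m) \is a fin_num by rewrite fin_num_measure.
  rewrite -(fineK PBfin) lee_fin.
  apply: (cvgr_to_ge bcvg); near=> n.
  have mn : (n0 + m <= n)%N by near: n; exact: nbhs_infty_ge.
  have [mA PA] := Ab n (leq_trans (leq_addr _ _) mn).
  rewrite -lee_fin fineK// (le_trans _ PA)//.
  by apply: le_measure; rewrite ?inE//; apply: bigcap_inf.
have mU : measurable (\bigcup_m B m) by exact: bigcup_measurable.
have Ub : (P (\bigcup_m B m) <= b%:E)%E.
  have ndB : nondecreasing_seq B.
    move=> m1 m2 m12; apply/subsetPset => w Bw n /= n0m; apply: Bw => /=.
    by rewrite (leq_trans _ n0m)// leq_add2l.
  have Ucvg : P (B m) @[m --> \oo] --> P (\bigcup_m B m).
    exact: nondecreasing_cvg_mu.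
  rewrite -(cvg_lim _ Ucvg)//; apply: lime_le.
    by apply/cvg_ex; eexists; exact: Ucvg.
  by near=> m; exact: Bb.
apply: (@le_trans _ _ (P (N `|` \bigcup_m B m))).
  apply: le_measure; rewrite ?inE//; first exact: measurableU.
  move=> w Ew; have [Qw|nQw] := pselect (E w -> \forall n \near \oo, A n w).
    right; have [m _ mA] := Qw Ew; exists m => // n /= mn.
    by apply: mA => /=; rewrite (leq_trans (leq_addl _ _) mn).
  by left; exact: NE.
apply: (@le_trans _ _ (P N + P (\bigcup_m B m))%E); first exact: measureU2.
by rewrite [X in (X + _)%E](_ : _ = 0%E) ?add0e.
Unshelve. all: by end_near. Qed.

(** A strict inequality for the limit holds eventually along the sequence. Each bound is thus proved
    first with a smaller radius on the right-hand side, which then increases to the given one; the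
    ball bound is turned into an upper bound by complementation. *)
Lemma gaussian_bounds_lim (Z_ : nat -> Omega -> R) (Z : Omega -> R)
    (v_ : nat -> R) (v : R) :
  0 < v -> v_ n @[n --> \oo] --> v -> measurable_fun setT Z ->
  (\forall n \near \oo, gaussian_bounds P (Z_ n) (v_ n)) ->
  {ae P, forall w, Z_ n w @[n --> \oo] --> Z w} ->
  gaussian_bounds P Z v.
Proof.
move=> v0 vcvg mZ Zb Zae; split => // [r|y e e0].
  (* Radius 0 leaves no smaller radius, but there the bound equals 2. *)
  rewrite le_eqVlt => /predU1P[<-|r0].
    rewrite (@le_trans _ _ 1%E) ?probability_le1//.
      rewrite -[X in measurable X]setTI.
      by apply: measurable_fun_le => //; exact: measurableT_comp.
    by rewrite lee_fin expr0n/= oppr0 mul0r expR0 mulr1 ler1n.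
  have key (r' : R) : 0 <= r' < r ->
      (P [set w | (r <= `|Z w|)%R] <= (2 * expR (- r' ^+ 2 / (2 * v)))%:E)%E.
    move=> /andP[r'0 r'r].
    apply: (prob_le_liminf _ (fun n => [set w | r' <= `|Z_ n w|])
      (fun n => 2 * expR (- r' ^+ 2 / (2 * v_ n)))).
    - rewrite -[X in measurable X]setTI.
      by apply: measurable_fun_le => //; exact: measurableT_comp.
    - near=> n; have [mZn Zu _] : gaussian_bounds P (Z_ n) (v_ n) by near: n.
      split; last exact: Zu.
      rewrite -[X in measurable X]setTI.
      by apply: measurable_fun_le => //; exact: measurableT_comp.
    - apply: cvgM; first exact: cvg_cst.
      apply: (cvg_comp _ expR); last exact: continuous_expR.
      apply: cvgM; first exact: cvg_cst.
      apply: cvgV; first by rewrite mulf_neq0// gt_eqF.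
      by apply: cvgM => //; exact: cvg_cst.
    - apply: filterS Zae => w Zw rZ.
      near=> n; apply: ltW; near: n.
      by apply: (cvgr_gt _ (cvg_norm Zw)); exact: lt_le_trans rZ.
  have PEfin : P [set w | r <= `|Z w|] \is a fin_num.
    rewrite fin_num_measure// -[X in measurable X]setTI.
    by apply: measurable_fun_le => //; exact: measurableT_comp.
  rewrite -(fineK PEfin) lee_fin.
  have lim : 2 * expR (- x ^+ 2 / (2 * v)) @[x --> r^'-] -->
      2 * expR (- r ^+ 2 / (2 * v)).
    apply: cvgM; first exact: cvg_cst.
    apply: (cvg_comp _ expR); last exact: continuous_expR.
    apply: cvgM; last exact: cvg_cst.
    apply: cvgN; apply: cvg_sqr; apply: cvg_at_left_filter; exact: cvg_id.
  apply: (cvgr_to_ge lim); near=> r'.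
  rewrite -lee_fin fineK//; apply: key; apply/andP; split; last by [].
  near: r'; exact: nbhs_left_ge.
pose Lb (x u : R) :=
  2 * x / Num.sqrt (2 * pi * u) * expR (- (`|y| + x) ^+ 2 / (2 * u)).
have Lb_cvg T (G : set_system T) (FG : Filter G) (f g : T -> R) (a u : R) : 0 < u ->
    f x @[x --> G] --> a -> g x @[x --> G] --> u ->
    Lb (f x) (g x) @[x --> G] --> Lb a u.
  move=> u0 fa gu; apply: cvgM.
    apply: cvgM; first by apply: cvgM => //; exact: cvg_cst.
    apply: cvgV; first by rewrite gt_eqF// sqrtr_gt0 !mulr_gt0// pi_gt0.
    apply: (cvg_comp _ Num.sqrt); last exact: sqrt_continuous.
    by apply: cvgM => //; exact: cvg_cst.
  apply: (cvg_comp _ expR); last exact: continuous_expR.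
  apply: cvgM.
    by apply: cvgN; apply: cvg_sqr; apply: cvgD => //; exact: cvg_cst.
  apply: cvgV; first by rewrite mulf_neq0// gt_eqF.
  by apply: cvgM => //; exact: cvg_cst.
have mball (f : Omega -> R) (x : R) : measurable_fun setT f ->
    measurable [set w | `|f w - y| < x].
  move=> mf; rewrite -[X in measurable X]setTI.
  rewrite (_ : [set w | _] = f @^-1` `](y - x), (y + x)[%classic); first exact: mf.
  by apply/seteqP; split => w; rewrite /= in_itv/= ltr_distl.
have setCE (f : Omega -> R) (x : R) :
    [set w | x <= `|f w - y|] = ~` [set w | `|f w - y| < x].
  by apply/seteqP; split => w /=; rewrite leNgt => /negP.
have key (x : R) : 0 < x < e -> ((Lb x v)%:E <= P [set w | (`|Z w - y| < e)%R])%E.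
  move=> /andP[x0 xe].
  have : (P [set w | (e <= `|Z w - y|)%R] <= (1 - Lb x v)%:E)%E.
    apply: (prob_le_liminf _ (fun n => [set w | x <= `|Z_ n w - y|])
      (fun n => 1 - Lb x (v_ n))).
    - by rewrite setCE; apply: measurableC; exact: mball.
    - near=> n; have [mZn _ Zl] : gaussian_bounds P (Z_ n) (v_ n) by near: n.
      have mA := mball _ x mZn; rewrite setCE; split; first exact: measurableC.
      by rewrite probability_setC// EFinB leeB// Zl.
    - apply: cvgB; first exact: cvg_cst.
      by apply: Lb_cvg => //; exact: cvg_cst.
    - apply: filterS Zae => w Zw eZ.
      near=> n; apply: ltW; near: n.
      have Zwy : Z_ n w - y @[n --> \oo] --> Z w - y.
        by apply: cvgB => //; exact: cvg_cst.
      by apply: (cvgr_gt _ (cvg_norm Zwy)); exact: lt_le_trans eZ.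
  rewrite setCE probability_setC//; last exact: mball.
  have PEfin : P [set w | `|Z w - y| < e] \is a fin_num.
    by rewrite fin_num_measure//; exact: mball.
  by rewrite -(fineK PEfin) -EFinB !lee_fin lerD2l lerN2.
have PEfin : P [set w | `|Z w - y| < e] \is a fin_num.
  by rewrite fin_num_measure//; exact: mball.
rewrite -(fineK PEfin) lee_fin.
have lim : Lb x v @[x --> e^'-] --> Lb e v.
  apply: Lb_cvg => //; last exact: cvg_cst.
  by apply: cvg_at_left_filter; exact: cvg_id.
apply: (cvgr_to_le lim); near=> x.
rewrite -lee_fin fineK//; apply: key; apply/andP; split; last by [].
near: x; exact: nbhs_left_gt.
Unshelve. all: by end_near. Qed.

End GaussianBoundsLimit.

End GaussianLimits.

(** * Variance and large deviations of the exact mean position *)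

Section OscillatorLDP.
Context {R : realType}.

(** The closed form of the integral of [(1 - cos s) ^+ 2] over [[0, t]]. *)
Definition oscillator_variance (t : R) : R :=
  3 / 2 * t - 2 * sin t + 2^-1 * (sin t * cos t).

Lemma is_derive_oscillator_variance (s : R) :
  is_derive s 1 oscillator_variance ((1 - cos s) ^+ 2).
Proof.
have ds := is_derive_sin s; have dc := is_derive_cos s.
apply: is_derive_eq.
change ((3 / 2) * 1 - 2 * cos s +
  2^-1 * (sin s * (- sin s) + cos s * cos s) = (1 - cos s) ^+ 2).
have -> : sin s * - sin s = cos s ^+ 2 - 1 by rewrite -(cos2Dsin2 s); ring.
by field.
Qed.

(** After reversing the index these are ordinary Riemann sums, that is, Riemann-Stieltjes sums with
    the identity as integrator. *)
Lemma oscillator_variance_cvg (T : R) : 0 < T ->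
  T / n%:R * (\sum_(k < n) (1 - cos ((n - k.+1)%:R * (T / n%:R))) ^+ 2) @[n --> \oo]
  --> oscillator_variance T.
Proof.
move=> T0.
have ccos : {within `[0, T], continuous (fun s : R => (1 - cos s) ^+ 2)}.
  apply: continuous_subspaceT => s; apply: cvg_sqr.
  by apply: cvgB; [exact: cvg_cst | exact: continuous_cos].
have cid : {within `[0, T], continuous (fun s : R => s)}.
  by apply: continuous_subspaceT => s; exact: cvg_id.
have cV : {within `[0, T], continuous oscillator_variance}.
  apply: continuous_subspaceT => s; apply: differentiable_continuous.
  by apply/derivable1_diffP; have [] := is_derive_oscillator_variance s.
have dV (s : R) : s \in `]0, T[ ->
    is_derive s 1 oscillator_variance ((1 - cos s) ^+ 2 * 1).
  by move=> _; rewrite mulr1; exact: is_derive_oscillator_variance.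
have := riemann_stieltjes_cvg T 1 _ _ (fun=> 1) _ T0 ccos cid cV
  (fun s _ => is_derive_id s 1) dV _.
rewrite normr1 => /(_ (fun=> lexx 1)).
rewrite [oscillator_variance 0](_ : _ = 0) ?subr0; last first.
  by rewrite /oscillator_variance sin0; ring.
apply: cvg_trans; apply: near_eq_cvg; near=> n.
rewrite [in LHS](reindex_inj rev_ord_inj)/= mulr_sumr; apply: eq_bigr => k _.
by rewrite -natr1; ring.
Unshelve. all: by end_near. Qed.

Lemma oscillator_variance_mean_cvg :
  t^-1 * oscillator_variance t @[t --> +oo] --> (3 / 2 : R).
Proof.
have inv0 : t^-1 @[t --> +oo] --> (0 : R).
  apply/gtr0_cvgV0; last exact: cvg_id.
  by near=> t; near: t; exact: nbhs_pinfty_gt.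
have bnd : t^-1 * (- 2 * sin t + sin t * cos t / 2) @[t --> +oo] --> (0 : R).
  apply/norm_cvg0P.
  have lim : t^-1 * 3 @[t --> +oo] --> (0 : R).
    by rewrite -(mul0r 3); apply: cvgM => //; exact: cvg_cst.
  apply: squeeze_cvgr (cvg_cst 0) lim.
  near=> t; rewrite normr_ge0/= normrM ger0_norm ?invr_ge0 ?ler_wpM2l ?invr_ge0//.
  have s1 := sin_max t; have c1 := cos_max t.
  rewrite (le_trans (ler_normD _ _))// !normrM normrN normfV.
  rewrite !(ger0_norm (ler0n _ _)).
  have : `|sin t| * `|cos t| <= 1 by rewrite mulr_ile1.
  lra.
have : 3 / 2 + t^-1 * (- 2 * sin t + sin t * cos t / 2) @[t --> +oo] -->
    (3 / 2 + 0 : R).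
  by apply: cvgD => //; exact: cvg_cst.
rewrite addr0; apply: cvg_trans; apply: near_eq_cvg; near=> t.
have t0 : 0 < t by near: t; exact: nbhs_pinfty_gt.
by rewrite /oscillator_variance; field; rewrite gt_eqF.
Unshelve. all: by end_near. Qed.


Section ExactMeanLDP.
Context d (Omega : measurableType d) (P : probability Omega R).
Context (F : R -> set (set Omega)) (W X Y : R -> Omega -> R) (alpha x0 y0 : R).
Hypothesis alpha0 : 0 < alpha.
Hypothesis hF : complete_filtration P F.
Hypothesis hW : standard_brownian_motion P F W.
Hypothesis hXY : stochastic_oscillator P F W alpha x0 y0 X Y.

(** The equation for [Y] expresses the integral of [X] through [Y T], [W T] and [W 0], but only
    almost surely; completeness of [P] carries the measurability over. *)
Lemma measurable_time_mean (T : R) : 0 < T -> measurable_fun setT (time_mean X T).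
Proof.
move=> T0; case: hF => _ FM _ cP _; case: hW => aW _ _ _ _.
case: hXY => _ aY solae.
have mW (t : R) : 0 <= t -> measurable_fun setT (W t).
  by move=> t0 _ B mB; rewrite setTI; apply: (FM t) => //; exact: aW.
have mY : measurable_fun setT (Y T).
  by move=> _ B mB; rewrite setTI; apply: (FM T (ltW T0)); exact: (aY T (ltW T0)).
pose g w : R := T^-1 * (y0 - Y T w + alpha * (W T w - W 0 w)).
have mg : measurable_fun setT g.
  apply: measurable_funM => //; apply: measurable_funD.
    exact: measurable_funB.
  by apply: measurable_funM => //; apply: measurable_funB;
    apply: mW => //; exact: ltW.
apply/measurable_EFinP; apply: (ae_measurable_fun cP (f := EFin \o g)).
  apply: filterS solae => w [_ _ sol] _ /=; congr EFin.
  have [_ YT] := sol T (ltW T0); rewrite /g /time_mean YT.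
  by congr (_ * _); ring.
exact/measurable_EFinP.
Qed.

(** The integral over [[0, T]] of the noise-free solution [x0 * cos s + y0 * sin s]. *)
Definition oscillator_drift (T : R) : R := y0 + x0 * sin T - y0 * cos T.

(** As the mesh [T / n] shrinks, the normal grid sums converge almost surely to the centred integral
    of [X] while their variances converge, so the bounds pass to the limit. *)
Lemma time_mean_bounds (T : R) : 0 < T -> 0 < oscillator_variance T ->
  gaussian_bounds P (fun w => time_mean X T w - T^-1 * oscillator_drift T)
    (T^-1 ^+ 2 * (alpha ^+ 2 * oscillator_variance T)).
Proof.
move=> T0 V0.
pose c n k : R := 1 - cos ((n - k.+1)%:R * (T / n%:R)).
pose s n : R := T / n%:R * (\sum_(k < n) c n k ^+ 2).
have a20 : 0 < alpha ^+ 2 by rewrite exprn_gt0.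
rewrite (_ : (fun w => _) =
  (fun w => T^-1 * (T * time_mean X T w - oscillator_drift T))); last first.
  by apply/funext => w; field; rewrite gt_eqF.
apply: gaussian_boundsZ; rewrite ?mulr_gt0 ?invr_eq0 ?gt_eqF//.
have s_cvg := oscillator_variance_cvg _ T0.
apply: (gaussian_bounds_lim _ _ _
  (fun n w => alpha * grid_sum W (T / n%:R) (c n) n w) _
  (fun n => alpha ^+ 2 * s n)).
- by rewrite mulr_gt0.
- by apply: cvgM => //; exact: cvg_cst.
- apply: measurable_funB => //; apply: measurable_funM => //.
  exact: measurable_time_mean.
- near=> n; have n0 : 0 < n%:R :> R by rewrite ltr0n; near: n; exact: nbhs_infty_gt.
  have sn0 : 0 < s n by near: n; exact: (cvgr_gt _ s_cvg).
  have dl0 : 0 < T / n%:R by rewrite divr_gt0.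
  apply: gaussian_boundsZ; rewrite ?gt_eqF//.
  apply: normal_law_bounds => //; first exact: (measurable_grid_sum hF hW dl0).
  move=> B mB; apply: (grid_sum_law hF hW dl0) => //.
  by move: sn0; rewrite pmulr_rgt0.
- case: hW => _ W0ae cWae _ _; case: hXY => _ _ solae.
  apply: filterS3 W0ae cWae solae => w W0 cW [cX cY sol].
  have := oscillator_mean_cvg _ _ _ _ _ _ T T0 cX cY cW W0 sol.
  rewrite /time_mean mulVKf ?gt_eqF//; exact.
Unshelve. all: by end_near. Qed.

Lemma time_mean_LDP :
  satisfies_LDP P +oo id (time_mean X) (EFin \o rate_exact alpha).
Proof.
(* The limit of time times variance is [3 / 2 * alpha ^+ 2], twice which is the denominator of the
   rate. *)
have -> : rate_exact alpha = (fun y => (2 * (3 / 2 * alpha ^+ 2))^-1 * y ^+ 2).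
  by apply/funext => y; rewrite /rate_exact; field; rewrite gt_eqF.
have a20 : 0 < alpha ^+ 2 by rewrite exprn_gt0.
apply: (@gaussian_LDP R _ _ P _ _ (pinfty_nbhs R) _ id
  (fun T => T^-1 * oscillator_drift T)
  (fun T => T^-1 ^+ 2 * (alpha ^+ 2 * oscillator_variance T)) (time_mean X)
  (3 / 2 * alpha ^+ 2)).
- by rewrite mulr_gt0.
- exact: cvg_id.
- apply/norm_cvg0P.
  have lim : t^-1 * (`|y0| + `|x0| + `|y0|) @[t --> +oo] --> (0 : R).
    rewrite -(mul0r (`|y0| + `|x0| + `|y0|)); apply: cvgM; last exact: cvg_cst.
    apply/gtr0_cvgV0; last exact: cvg_id.
    by near=> t; near: t; exact: nbhs_pinfty_gt.
  apply: squeeze_cvgr (cvg_cst 0) lim.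
  near=> t; rewrite normr_ge0/= normrM ger0_norm ?invr_ge0 ?ler_wpM2l ?invr_ge0//.
  rewrite (le_trans (ler_normB _ _))// lerD//.
    by rewrite (le_trans (ler_normD _ _))// lerD// normrM ler_piMr// sin_max.
  by rewrite normrM ler_piMr// cos_max.
- have : alpha ^+ 2 * (t^-1 * oscillator_variance t) @[t --> +oo] -->
    alpha ^+ 2 * (3 / 2).
    by apply: cvgM; [exact: cvg_cst | exact: oscillator_variance_mean_cvg].
  rewrite mulrC; apply: cvg_trans; apply: near_eq_cvg; near=> t.
  have t0 : 0 < t by near: t; exact: nbhs_pinfty_gt.
  by field; rewrite gt_eqF.
near=> t.
have t0 : 0 < t by near: t; exact: nbhs_pinfty_gt.
have V0 : 0 < oscillator_variance t.
  have : 0 < t^-1 * oscillator_variance t.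
    by near: t; apply: (cvgr_gt _ oscillator_variance_mean_cvg).
  by rewrite pmulr_rgt0// invr_gt0.
split; last exact: time_mean_bounds.
by rewrite mulr_gt0 ?exprn_gt0 ?invr_gt0// mulr_gt0.
Unshelve. all: by end_near. Qed.

End ExactMeanLDP.

End OscillatorLDP.

(** * Symplecticity and the small step-size limit *)

Section Symplecticity.
Context {R : realType}.

(** A continuous linear functional is its own differential; continuity is read off from the
    coordinates. *)
Lemma is_diff_affine_coord (B : 'M[R]_2) (i : 'I_2) (c : R) (z : 'cV[R]_2) :
  is_diff z (fun z : 'cV[R]_2 => (B *m z) i 0 + c) (fun u => (B *m u) i 0).
Proof.
have lin : linear (fun z : 'cV[R]_2 => (B *m z) i 0 : R^o).
  by move=> k u v; rewrite mulmxDr -scalemxAr !mxE.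
pose f : {linear 'cV[R]_2 -> R^o} :=
  HB.pack (fun z : 'cV[R]_2 => (B *m z) i 0 : R^o)
  (GRing.isLinear.Build _ _ _ _ _ lin).
have cf : continuous f.
  have cZ j : continuous (fun z : 'cV[R]_2 => B i j * z j 0 : R).
    move=> x; apply: (@cvgM _ _ (nbhs x) _ (cst (B i j))
      (fun z : 'cV[R]_2 => z j 0)).
      exact: cvg_cst.
    exact: coord_continuous.
  rewrite (_ : (f : 'cV[R]_2 -> R) = (fun z => B i 0 * z 0 0 + B i 1 * z 1 0)).
    by move=> x; apply: (cvgD (cZ 0 x) (cZ 1 x)).
  by apply/funext => u; rewrite -mul_mx2E.
have df : is_diff z (f : 'cV[R]_2 -> R) f.
  by apply: DiffDef; [exact: linear_differentiable | exact: diff_lin].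
have := is_diffD df (is_diff_cst (c : R) z); rewrite addr0; exact.
Qed.

(** For fixed [w] the noise only adds a constant, so the differential of step [m] in the initial
    datum is [A ^+ m], and the wedge is the standard area form times [\det (A ^+ m) = 1]. *)
Lemma symplectic_of_det1 d (Omega : measurableType d) (A : 'M[R]_2) (b : 'cV[R]_2)
    (alpha h : R) (W : R -> Omega -> R) :
  \det A = 1 -> symplectic_method A b alpha h W.
Proof.
move=> detA w n x y z.
have xyE m i : exists c, (fun z => numsol A b alpha h W z m w i 0) =
    (fun z : 'cV[R]_2 => (A ^+ m *m z) i 0 + c).
  by eexists; apply/funext => u; rewrite numsolE mxE; reflexivity.
have dxy m i z' : is_diff z' (fun z => numsol A b alpha h W z m w i 0)
    (fun u => (A ^+ m *m u) i 0).
  by have [c ->] := xyE m i; exact: is_diff_affine_coord.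
have detX m : \det (A ^+ m) = 1.
  elim: m => [|m IH]; first by rewrite expr0 det1.
  by rewrite exprS det_mulmx IH detA mulr1.
have wedgeE m u v : wedge (x m) (y m) z u v = u 0 0 * v 1 0 - v 0 0 * u 1 0.
  have dx : 'd (x m) z = (fun u => (A ^+ m *m u) 0 0) :> ('cV[R]_2 -> R).
    by have [] := dxy m 0 z.
  have dy : 'd (y m) z = (fun u => (A ^+ m *m u) 1 0) :> ('cV[R]_2 -> R).
    by have [] := dxy m 1 z.
  rewrite /wedge dx dy.
  have := detX m; rewrite det_mx22 => dB; rewrite !mul_mx2E.
  rewrite -[RHS]mul1r -dB; ring.
split; first by have [] := dxy n 0 z.
  by have [] := dxy n 1 z.
by move=> u v; rewrite !wedgeE.
Qed.

End Symplecticity.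

(** * Limit of the modified rate function for vanishing step-size *)

Section SmallStepLimit.
Context {R : realType}.

Lemma bigO_div_cvg0 (f g : R -> R) (K : R) :
  (\forall h \near (0 : R)^'+, `|f h| <= g h) ->
  (\forall h \near (0 : R)^'+, `|g h| <= K * `|h ^+ 2|) ->
  f h / h @[h --> 0^'+] --> (0 : R).
Proof.
move=> fg gK; apply/norm_cvg0P.
have lim : K * h @[h --> 0^'+] --> (0 : R).
  rewrite -[X in _ --> X](mulr0 K); apply: cvgM; first exact: cvg_cst.
  by apply: cvg_at_right_filter; exact: cvg_id.
apply: squeeze_cvgr (cvg_cst 0) lim; near=> h.
have h0 : 0 < h by near: h; exact: nbhs_right_gt.
rewrite normr_ge0/= normrM normfV (gtr0_norm h0) ler_pdivrMr// -mulrA -expr2.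
have gKh : `|g h| <= K * `|h ^+ 2| by near: h.
rewrite (ger0_norm (sqr_ge0 h)) in gKh.
rewrite (le_trans _ gKh)// (le_trans _ (ler_norm _))//.
by near: h.
Unshelve. all: by end_near. Qed.

(** The trace is [2 - h ^+ 2 * th h] and [b1 + a12 b2 - a22 b1] is [h * L h], with [th] and [L]
    tending to 1. The numerator thus carries [h ^+ 4] and the denominator [h ^+ 3], and the division
    by [h] removes what is left. *)
Lemma rate_h_cvg (alpha : R) (A : R -> 'M[R]_2) (b : R -> 'cV[R]_2) (y : R) :
  0 < alpha -> (\forall h \near (0 : R)^'+, condA2 (A h)) -> condB A b ->
  rate_h (A h) (b h) alpha h y / h @[h --> 0^'+] --> rate_exact alpha y.
Proof.
move=> alpha0 detA [/eqO_bigO OA /eqO_bigO Ob].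
have [K KA] : exists K : R, \forall h \near (0 : R)^'+,
   `| `|A h 0 0 - 1| + `|A h 1 1 - 1| + `|A h 0 1 - h| + `|A h 1 0 + h| | <=
     K * `|h ^+ 2|.
  by have := @filter_ex _ _ _ _ OA; exact.
have [K' Kb] : exists K : R, \forall h \near (0 : R)^'+,
   `| `|b h 0 0| + `|b h 1 0 - 1| | <= K * `|h|.
  by have := @filter_ex _ _ _ _ Ob; exact.
have id0 : h @[h --> 0^'+] --> (0 : R) by apply: cvg_at_right_filter; exact: cvg_id.
(* Deviations from the explicit Euler matrix, rescaled by [h]; the bound of order [h ^+ 2] makes
   them tend to 0. *)
pose e1 h := (A h 0 0 - 1) / h; pose e2 h := (A h 1 1 - 1) / h.
pose e3 h := (A h 0 1 - h) / h; pose e4 h := (A h 1 0 + h) / h.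
have small f : (\forall h \near (0 : R)^'+, `|f h| <=
    `|A h 0 0 - 1| + `|A h 1 1 - 1| + `|A h 0 1 - h| + `|A h 1 0 + h|) ->
    f h / h @[h --> 0^'+] --> (0 : R).
  by move=> fle; apply: bigO_div_cvg0 fle KA.
have n0 (x : R) : 0 <= `|x| := normr_ge0 x.
have [e1_cvg e2_cvg e3_cvg e4_cvg] : [/\ e1 h @[h --> 0^'+] --> (0 : R),
    e2 h @[h --> 0^'+] --> (0 : R), e3 h @[h --> 0^'+] --> (0 : R) &
    e4 h @[h --> 0^'+] --> (0 : R)].
  by split; apply: small; near=> h; move: (n0 (A h 0 0 - 1)) (n0 (A h 1 1 - 1))
    (n0 (A h 0 1 - h)) (n0 (A h 1 0 + h)); lra.
have K'h : K' * `|h| @[h --> 0^'+] --> (0 : R).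
  rewrite -[X in _ --> X](mulr0 K'); apply: cvgM; first exact: cvg_cst.
  by rewrite -[X in _ --> X](@normr0 _ R); exact: cvg_norm.
have b1_cvg : b h 0 0 @[h --> 0^'+] --> (0 : R).
  apply/norm_cvg0P; apply: squeeze_cvgr (cvg_cst 0) K'h; near=> h.
  have : `| `|b h 0 0| + `|b h 1 0 - 1| | <= K' * `|h| by near: h.
  by rewrite ger0_norm ?addr_ge0//; move: (n0 (b h 0 0)) (n0 (b h 1 0 - 1)); lra.
have b2_cvg : b h 1 0 @[h --> 0^'+] --> (1 : R).
  have : b h 1 0 - 1 @[h --> 0^'+] --> (0 : R).
    apply/norm_cvg0P; apply: squeeze_cvgr (cvg_cst 0) K'h; near=> h.
    have : `| `|b h 0 0| + `|b h 1 0 - 1| | <= K' * `|h| by near: h.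
    by rewrite ger0_norm ?addr_ge0//; move: (n0 (b h 0 0)) (n0 (b h 1 0 - 1)); lra.
  by move/subr_cvg0.
(* By [\det A = 1], [2 - \tr A = h ^+ 2 * th h]. *)
pose th h := 1 + e1 h * e2 h + e3 h - e4 h - e3 h * e4 h.
have th_cvg : th h @[h --> 0^'+] --> (1 : R).
  have -> : (1 : R) = 1 + 0 * 0 + 0 - 0 - 0 * 0 by ring.
  apply: cvgB; last exact: cvgM.
  apply: cvgB => //; apply: cvgD => //; apply: cvgD; first exact: cvg_cst.
  exact: cvgM.
pose tau h := 2 - h ^+ 2 * th h.
have tau_cvg : tau h @[h --> 0^'+] --> (2 : R).
  have -> : (2 : R) = 2 - 0 ^+ 2 * 1 by ring.
  apply: cvgB; first exact: cvg_cst.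
  by apply: cvgM => //; exact: cvg_sqr.
pose L h := - e2 h * b h 0 0 + (1 + e3 h) * b h 1 0.
have L_cvg : L h @[h --> 0^'+] --> (1 : R).
  have -> : (1 : R) = - 0 * 0 + (1 + 0) * 1 by ring.
  apply: cvgD; first by apply: cvgM => //; exact: cvgN.
  by apply: cvgM => //; apply: cvgD => //; exact: cvg_cst.
pose be h := A h 0 1 * b h 1 0 - A h 1 1 * b h 0 0.
have be_cvg : be h @[h --> 0^'+] --> (0 : R).
  have : h * L h - b h 0 0 @[h --> 0^'+] --> (0 * 1 - 0 : R).
    by apply: cvgB => //; exact: cvgM.
  rewrite mul0r subr0; apply: cvg_trans; apply: near_eq_cvg; near=> h.
  have h0 : h != 0 by near: h; exact: nbhs_right_neq.
  by rewrite /be /L /e2 /e3; field.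
have : (2 + tau h) * th h ^+ 2 * y ^+ 2 / (2 * alpha ^+ 2 *
    (L h ^+ 2 * (4 + tau h) - 2 * b h 0 0 * be h * th h)) @[h --> 0^'+] -->
    rate_exact alpha y.
  (* At the limit values the quotient is [4 * y ^+ 2 / (12 * alpha ^+ 2)]. *)
  have -> : rate_exact alpha y = (2 + 2) * 1 ^+ 2 * y ^+ 2 / (2 * alpha ^+ 2 *
    (1 ^+ 2 * (4 + 2) - 2 * 0 * 0 * 1)) by rewrite /rate_exact; field; rewrite gt_eqF.
  apply: cvgM.
    apply: cvgM; last exact: cvg_cst.
    apply: cvgM; last exact: cvg_sqr.
    by apply: cvgD => //; exact: cvg_cst.
  apply: cvgV.
    have -> : 1 ^+ 2 * (4 + 2) - 2 * 0 * 0 * 1 = 6 :> R by ring.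
    by rewrite gt_eqF// !mulr_gt0// exprn_gt0.
  apply: cvgM; first exact: cvg_cst.
  apply: cvgB.
    by apply: cvgM; [exact: cvg_sqr | apply: cvgD => //; exact: cvg_cst].
  apply: cvgM => //; apply: cvgM => //; apply: cvgM => //; exact: cvg_cst.
apply: cvg_trans; apply: near_eq_cvg; near=> h.
have h0 : h != 0 by near: h; exact: nbhs_right_neq.
have trE : \tr (A h) = tau h.
  have : condA2 (A h) by near: h.
  rewrite /condA2 det_mx22 => dA; rewrite tr_mx22.
  have thE : h ^+ 2 * th h = 2 - (A h 0 0 + A h 1 1) +
      (A h 0 0 * A h 1 1 - A h 0 1 * A h 1 0 - 1).
    by rewrite /th /e1 /e2 /e3 /e4; field.
  by rewrite /tau thE dA subrr addr0; ring.
rewrite /rate_h/= trE.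
have -> : b h 0 0 + A h 0 1 * b h 1 0 - A h 1 1 * b h 0 0 = h * L h.
  by rewrite /L /e2 /e3; field.
rewrite -/(be h).
have -> : 2 - tau h = h ^+ 2 * th h by rewrite /tau; ring.
have -> : 2 * alpha ^+ 2 * h * ((h * L h) ^+ 2 * (4 + tau h) -
   2 * b h 0 0 * be h * (h ^+ 2 * th h)) =
   h ^+ 3 * (2 * alpha ^+ 2 *
     (L h ^+ 2 * (4 + tau h) - 2 * b h 0 0 * be h * th h)) by ring.
set D := 2 * alpha ^+ 2 * _.
have -> : (2 + tau h) * (h ^+ 2 * th h) ^+ 2 * y ^+ 2 =
  (h ^+ 3 * h) * ((2 + tau h) * th h ^+ 2 * y ^+ 2) by ring.
by move: D => D; rewrite invfM; move: D^-1 => D'; field.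
Unshelve. all: by end_near. Qed.

End SmallStepLimit.

(** * Symplecticity, discrete large deviations and their asymptotic preservation combined *)

Theorem theorem4p3 (R : realType) (d : measure_display)
    (Omega : measurableType d) (P : probability Omega R)
    (F : R -> set (set Omega)) (W : R -> Omega -> R)
    (alpha x0 y0 : R) (A : R -> 'M[R]_2) (b : R -> 'cV[R]_2)
    (halpha : 0 < alpha)
    (hF : complete_filtration P F)
    (hW : standard_brownian_motion P F W) :
  [/\ forall h : R, 0 < h ->
        nonzero_noise (b h) -> condA1 (A h) -> condA2 (A h) ->
        symplectic_method (A h) (b h) alpha h W,
      forall h : R, 0 < h ->
        nonzero_noise (b h) -> condA1 (A h) -> condA2 (A h) ->
        satisfies_LDP P \oo (fun N : nat => N%:R)
          (discrete_mean (A h) (b h) alpha h W (point2 x0 y0))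
          (EFin \o rate_h (A h) (b h) alpha h) /\
        good_rate_function (EFin \o rate_h (A h) (b h) alpha h) &
      forall X Y : R -> Omega -> R,
        stochastic_oscillator P F W alpha x0 y0 X Y ->
        (\forall h \near 0^'+,
           [/\ nonzero_noise (b h), condA1 (A h) & condA2 (A h)]) ->
        condB A b ->
        asymptotically_preserves_LDP P
          (fun h : R => discrete_mean (A h) (b h) alpha h W (point2 x0 y0))
          (fun h : R => rate_h (A h) (b h) alpha h)
          (time_mean X)
          (rate_exact alpha) /\
        good_rate_function (EFin \o rate_exact alpha)].
Proof.
split=> [h h0 hb hA1 hA2|h h0 hb hA1 hA2|X Y hXY hA hB].
- exact: symplectic_of_det1.
- split; last exact: good_rate_h.
  exact: discrete_mean_LDP hF hW.
split.
  split.
  - near=> h.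
    have h0 : 0 < h by near: h; exact: nbhs_right_gt.
    have [hb hA1 hA2] : [/\ nonzero_noise (b h), condA1 (A h) & condA2 (A h)].
      by near: h; exact: hA.
    exact: discrete_mean_LDP hF hW.
  - exact: time_mean_LDP hXY.
  - move=> y; apply: rate_h_cvg => //.
    by apply: filterS hA => h [].
have -> : rate_exact alpha = (fun y => (3 * alpha ^+ 2)^-1 * y ^+ 2).
  by apply/funext => y; rewrite /rate_exact mulrC.
by apply: good_rate_quadratic; rewrite invr_gt0 mulr_gt0// exprn_gt0.
Unshelve. all: by end_near. Qed.
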